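(* Let $\sigma\subset\mathbb{R}^2$ be a strongly convex cone (in the normal form given in the context) and let $\mathcal{T}$ be the Whitney stratification of the toric surface $X_\sigma\subset\mathbb{C}^n$ whose strata are the torus orbits $T_{\Delta_0},T_{\Delta_1},T_{\Delta_2},T_{\Delta_3}$. Then a non-degenerate polynomial function $g:(X_\sigma,0)\to(\mathbb{C},0)$ has an isolated singularity at the origin (in the stratified sense, with respect to $\mathcal{T}$) if and only if $$g(z_1,\dots,z_n)=c_1z_1^{p_1}+h(z_1,\dots,z_n)+c_nz_n^{p_n},$$ where $h$ is a polynomial function on $X_\sigma$, $c_1,c_n\in\mathbb{C}^*$ and $p_1,p_n$ are positive integers, and where $h$ contains neither of the monomials $z_1^{p_1}$, $z_n^{p_n}$ (as elements of $\mathbb{C}[S_\sigma]$), so that these monomials really occur in $g$.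
   Context: **Toric surface.** $\sigma\subset\mathbb{R}^2$ is generated by $v_1=pe_1-qe_2$ and $v_2=e_2$ with $0<q<p$ coprime integers (every strongly convex cone considered is put in this form). Let $\check\sigma$ be the dual cone and $S_\sigma=\check\sigma\cap\mathbb{Z}^2$. Write the Hirzebruch–Jung continued fraction $\frac{p}{p-q}=a_2-\frac{1}{a_3-\frac{1}{\cdots-\frac{1}{a_{n-1}}}}$ with integers $a_i\ge2$. The minimal generators of $S_\sigma$ are $\mu_1=(1,0)$, $\mu_2=(1,1)$, $\mu_{i+1}=a_i\mu_i-\mu_{i-1}$ $(2\le i\le n-1)$, with $\mu_n=(q,p)$. $X_\sigma=\mathrm{Spec}\,\mathbb{C}[S_\sigma]$ is embedded in $\mathbb{C}^n$ with coordinate $z_i$ corresponding to $\mu_i$. The torus orbits are $T_{\Delta_0}=\{0\}$, $T_{\Delta_1}=\{(t_1,0,\dots,0):t_1\in\mathbb{C}^*\}$, $T_{\Delta_2}=\{(0,\dots,0,t_1^qt_2^p):t_1,t_2\in\mathbb{C}^*\}$, and $T_{\Delta_3}\cong(\mathbb{C}^* )^2$ the open orbit $\{(t_1,t_1t_2,t_1^{\mu_3^1}t_2^{\mu_3^2},\dots,t_1^qt_2^p)\}$ where $\mu_i=(\mu_i^1,\mu_i^2)$; here $\Delta_0=\{0\}$, $\Delta_1=\mathbb{R}_{\ge0}\mu_1$, $\Delta_2=\mathbb{R}_{\ge0}\mu_n$, $\Delta_3=\check\sigma$ are the faces of $\check\sigma$. **Non-degeneracy.** A polynomial function on $X_\sigma$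 is an element $g=\sum_{v\in S_\sigma}a_v\cdot v\in\mathbb{C}[S_\sigma]$; $\Gamma_+(g)$ is the convex hull of $\bigcup_{a_v\ne0}(v+\check\sigma)$. $g$ is non-degenerate if for every compact face $\gamma$ of $\Gamma_+(g)$ the hypersurface $\{x\in(\mathbb{C}^* )^2:\sum_{v\in\gamma\cap S_\sigma}a_vx^v=0\}$ is smooth and reduced. **Stratified isolated singularity.** $g$ has an isolated singularity at $0$ in the stratified sense if $0$ is an isolated point of $\bigcup_i\Sigma(g|_{T_{\Delta_i}})$, the union of the critical loci of the restrictions to the strata. *)

(* Defs.v *)
From HB Require Import structures.
From mathcomp Require Import all_boot all_order all_algebra.
From mathcomp Require Import finmap complex.
From mathcomp Require Import all_classical all_reals all_analysis.
From mathcomp Require monalg.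
Import -(notations) monalg.

Set Implicit Arguments.
Unset Strict Implicit.
Unset Printing Implicit Defensive.

Import Order.TTheory GRing.Theory Num.Theory.
Import numFieldNormedType.Exports.

Local Open Scope classical_set_scope.
Local Open Scope ring_scope.

(* The alias ^o carries the structure of a normed space over R[i] itself, so
   that derivatives of functions of type CC R -> _ are holomorphic ones. *)
Notation CC R := (R[i]^o).
Notation lattice := (int * int)%type.

(* Finitely supported maps from the lattice to C, i.e. C[Z^2] as a vector
   space; the basis vector of v is the character x^v. The ring structure of
   monalg is not available here because Z^2 has nontrivial units. *)
Notation laurent R := (malg lattice R[i]).

Definition monomial (R : realType) (v : lattice) : laurent R :=
  mkmalgU v (1 : R[i]).

Definition laurent_eval (R : realType) (f : laurent R) (x1 x2 : CC R) : CC R :=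
  \sum_(v <- msupp f) (mcoeff v f : CC R) * (x1 ^ v.1 * x2 ^ v.2).

Section Cone.
Variables (R : realType) (p q : nat).

Definition dot (u v : R * R) : R := u.1 * v.1 + u.2 * v.2.

Definition sigma : set (R * R) :=
  [set u | exists l1 l2 : R, [/\ 0 <= l1, 0 <= l2 &
     u = l1 *: ((p%:R, - q%:R) : R * R) + l2 *: ((0, 1) : R * R)]].

Definition sigma_dual : set (R * R) :=
  [set m | forall u, sigma u -> 0 <= dot m u].

Definition emb (v : lattice) : R * R := (v.1%:~R, v.2%:~R).

Definition S_sigma : set lattice := [set v | sigma_dual (emb v)].

(* C[S_sigma] as a subset of C[Z^2]. *)
Definition poly_fun (g : laurent R) : Prop :=
  forall v, v \in msupp g -> S_sigma v.

Definition newton (g : laurent R) : set (R * R) :=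
  smallest (@convex_set R (R * R)%type)
    (\bigcup_(v in [set v | v \in msupp g])
       [set emb v + y | y in sigma_dual]).

(* Nonempty faces; w = 0 gives G itself. *)
Definition is_face (G F : set (R * R)) : Prop :=
  F !=set0 /\
  exists w, F = [set x | G x /\ forall y, G y -> dot w x <= dot w y].

Definition face_part (g : laurent R) (F : set (R * R)) : laurent R :=
  \sum_(v <- msupp g | `[< F (emb v) >])
     mcoeff v g *: monomial R v.

(* The subscheme of the torus defined by f is smooth (Jacobian criterion). *)
Definition smooth_hypersurface (f : laurent R) : Prop :=
  forall x1 x2 : CC R, x1 != 0 -> x2 != 0 -> laurent_eval f x1 x2 = 0 ->
    ~ (derive1 (fun t : CC R => laurent_eval f t x2) x1 = 0 /\
       derive1 (fun t : CC R => laurent_eval f x1 t) x2 = 0).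

(* f divides h in C[Z^2]; a Laurent polynomial is determined by its values
   on the torus. *)
Definition laurent_dvd (f : laurent R) (h : CC R -> CC R -> CC R) : Prop :=
  exists u : laurent R, forall x1 x2 : CC R, x1 != 0 -> x2 != 0 ->
    h x1 x2 = laurent_eval f x1 x2 * laurent_eval u x1 x2.

(* C[Z^2]/(f) has no nonzero nilpotent. *)
Definition reduced_hypersurface (f : laurent R) : Prop :=
  forall (h : laurent R) (m : nat),
    laurent_dvd f (fun x1 x2 => laurent_eval h x1 x2 ^+ m) ->
    laurent_dvd f (laurent_eval h).

Definition newton_nondegenerate (g : laurent R) : Prop :=
  forall F, is_face (newton g) F -> compact F ->
    smooth_hypersurface (face_part g F) /\
    reduced_hypersurface (face_part g F).

End Cone.

(* a_2 - 1/(a_3 - 1/(... - 1/a_(n-1))) for s = [:: a_2; ...; a_(n-1)]. *)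
Fixpoint hj_frac (s : seq nat) : rat :=
  match s with
  | [::] => 0
  | [:: a] => a%:R
  | a :: s' => a%:R - (hj_frac s')^-1
  end.

(* hj_gen s i is mu_(i+1). *)
Fixpoint hj_gen (s : seq nat) (i : nat) : lattice :=
  match i with
  | 0 => (1, 0)
  | i1.+1 =>
    match i1 with
    | 0 => (1, 1)
    | i2.+1 => hj_gen s i1 *+ nth 0%N s i2 - hj_gen s i2
    end
  end.

(* In this section n = size s + 2 and the coordinate z_i is z 0 (i - 1). *)
Section Embedding.
Variables (R : realType) (p q : nat) (s : seq nat).

Notation Cn := ('rV[CC R]_(size s).+2).

(* The element z_(i+1)^k of C[S_sigma]. *)
Definition coord_pow (i : 'I_(size s).+2) (k : nat) : laurent R :=
  monomial R (hj_gen s i *+ k).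

(* Value at z of the character of v in S_sigma: z_1^k_1 ... z_n^k_n for any
   k with v = sum_i k_i mu_i. For z in X_sigma it does not depend on k. *)
Definition char_at (z : Cn) (v : lattice) : CC R :=
  xget 0 [set w : CC R | exists k : 'I_(size s).+2 -> nat,
    v = \sum_(i < (size s).+2) hj_gen s i *+ k i /\
    w = \prod_(i < (size s).+2) z 0 i ^+ k i].

Definition eval_at (g : laurent R) (z : Cn) : CC R :=
  \sum_(v <- msupp g) (mcoeff v g : CC R) * char_at z v.

Definition orbit0 : set Cn := [set 0].

Definition orbit1 : set Cn :=
  [set z | exists2 t1 : CC R, t1 != 0 &
     z = \row_i (if i == ord0 then t1 else 0)].

Definition orbit2 : set Cn :=
  [set z | exists t1 t2 : CC R, [/\ t1 != 0, t2 != 0 &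
     z = \row_i (if i == ord_max then t1 ^+ q * t2 ^+ p else 0)]].

Definition orbit3 : set Cn :=
  [set z | exists t1 t2 : CC R, [/\ t1 != 0, t2 != 0 &
     z = \row_i (t1 ^ (hj_gen s i).1 * t2 ^ (hj_gen s i).2)]].

Definition strata : set (set Cn) := [set orbit0; orbit1; orbit2; orbit3].

(* Critical points of the restriction of f to a complex submanifold T: the
   differential kills the velocities of all holomorphic curves in T. *)
Definition crit_locus (f : Cn -> CC R) (T : set Cn) : set Cn :=
  [set z | T z /\ forall c : CC R -> Cn, c 0 = z ->
     (\forall t \near (0 : CC R), T (c t) /\ derivable c t 1) ->
     is_derive (0 : CC R) 1 (f \o c) 0].

Definition isolated_singularity (g : laurent R) : Prop :=
  isolated (\bigcup_(T in strata) crit_locus (eval_at g) T) 0.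

End Embedding.

(* Main.v *)
Require Import Defs.
From mathcomp Require Import all_boot all_order all_algebra.
From mathcomp Require Import finmap complex.
From mathcomp Require Import all_classical all_reals all_analysis.
From mathcomp Require monalg.
Import -(notations) monalg.
From mathcomp Require Import zify ring lra.
Import Order.TTheory GRing.Theory Num.Theory.
Import numFieldNormedType.Exports.
Local Open Scope classical_set_scope.
Local Open Scope ring_scope.

(** The one-dimensional orbits are punctured axes. A character of the cone
    survives on an axis only if it is a multiple of the generator spanning the
    corresponding edge, so there [g] is a polynomial [P] in the coordinate, and
    the coefficient of degree [k] of [P] is that of the [k]-th multiple of the
    generator in [g] ([eval_at_axis]). If [P] is constant, the whole axis is
    critical ([axis_critical]); otherwise the zeros of its derivative are
    isolated ([axis_noncritical]). The monomials of the normal form are thus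
    exactly what isolation on the two axes amounts to.

    There remains the open orbit, where nondegeneracy keeps the critical points
    away from the origin ([torus_noncritical]). If they accumulated at the
    origin, one could take an ultrafilter of critical points [x] converging to
    it; it plays the part of the curve given by the curve selection lemma. The
    critical points satisfy [sum_v a_v v x^v = 0]. Along the ultrafilter, there
    are two cases ([torus_degeneration]).
    - One character dominates all the others. Dividing by it gives [a_v v = 0]
      in the limit for this [v], although [v] is not zero.
    - Two characters remain comparable, so that [x^u] has a nonzero limit [b]
      for some primitive [u]. Complete [u] to a basis [(u, m)] of the lattice.
      Then [x^v] is [x^u] to the power [det (v, m)] times [x^m] to the power
      [det (u, v)]. As the characters of both edge generators tend to 0, the
      sign of [u] may be chosen so that [x^m] tends to 0 and the weight
      [det (u, _)] is positive on both edges. Dividing by the least power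
      of [x^m] leaves, in the limit, the same equation restricted to the
      exponents of least weight.

    These exponents form a face of the Newton polyhedron, which is a segment,
    hence compact, because the weight is positive on the cone ([newton_face]).
    The limit equation says that both derivatives of the face polynomial vanish
    at a point of the torus. The face polynomial is quasihomogeneous of nonzero
    degree, so it vanishes there too by Euler's relation, against smoothness
    ([nondegenerate_no_singular]).

    To evaluate [g] on the orbits one needs to know the semigroup of the cone.
    Consecutive generators form a basis of the lattice, and the continued
    fraction says that the last one is [(q, p)]; hence they generate the whole
    semigroup ([hj_gen_span]), and the first and the last span its edges. *)

Set Implicit Arguments.
Unset Strict Implicit.
Unset Printing Implicit Defensive.

(** * Continued fractions and the generators of the semigroup *)

Definition det2 (u v : lattice) : int := u.1 * v.2 - u.2 * v.1.

(** Numerator and denominator of the continued fraction, by the recursion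
    [a - D / N = (a N - D) / N]. The empty fraction counts as [1 / 0], which
    makes the recursion uniform. *)
Fixpoint hj_numden (s : seq nat) : int * int :=
  if s is a :: s'
  then (a%:Z * (hj_numden s').1 - (hj_numden s').2, (hj_numden s').1)
  else (1, 0).

Lemma fst_mulrn (u : lattice) n : (u *+ n).1 = u.1 *+ n.
Proof. exact: (raddfMn fst). Qed.

Lemma snd_mulrn (u : lattice) n : (u *+ n).2 = u.2 *+ n.
Proof. exact: (raddfMn snd). Qed.

Lemma mulrn_lattice_inj (v : lattice) : v != 0 -> injective (fun n => v *+ n).
Proof.
case: v => x y v0 m n /eqP; move: v0; rewrite -!pair_eqE /pair_eq /=.
rewrite !fst_mulrn !snd_mulrn !pmulrn !mulrzz.
by case/nandP=> z0 /andP[/eqP E1 /eqP E2];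
  [move: E1|move: E2] => /(mulfI z0) [->].
Qed.

Lemma fst_sum (I : Type) (r : seq I) (P : pred I) (F : I -> lattice) :
  (\sum_(i <- r | P i) F i).1 = \sum_(i <- r | P i) (F i).1.
Proof. exact: (raddf_sum fst). Qed.

Lemma snd_sum (I : Type) (r : seq I) (P : pred I) (F : I -> lattice) :
  (\sum_(i <- r | P i) F i).2 = \sum_(i <- r | P i) (F i).2.
Proof. exact: (raddf_sum snd). Qed.

Lemma hj_genSS s i :
  hj_gen s i.+2 = hj_gen s i.+1 *+ nth 0%N s i - hj_gen s i.
Proof. by []. Qed.

Lemma hj_numden_bounds s : all (fun a => (2 <= a)%N) s ->
  0 <= (hj_numden s).2 /\ (hj_numden s).2 < (hj_numden s).1.
Proof.
elim: s => [|a s IHs] //= /andP[a2 /IHs[h1 h2]]; split; first lia.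
nia.
Qed.

Lemma hj_numden_coprime s : coprimez (hj_numden s).1 (hj_numden s).2.
Proof.
elim: s => [|a s IHs] //=.
by rewrite /coprimez gcdzC gcdzMDl gcdzN.
Qed.

(** The right-hand side vanishes for the empty list, whose fraction [1 / 0] is
    represented by 0 in [hj_frac]. *)
Lemma hj_fracE s : all (fun a => (2 <= a)%N) s ->
  hj_frac s * (hj_numden s).2%:~R = (hj_numden s).1%:~R *+ (s != [::]).
Proof.
elim: s => [|a [|b s] IHs]; first by rewrite mul0r.
  by move=> _ /=; rewrite !mulr1 !subr0.
move=> /andP[a2 hs]; have [h1 h2] := @hj_numden_bounds (b :: s) hs.
have := IHs hs; rewrite [hj_frac (a :: _)]/(_ - (hj_frac (b :: s))^-1).
have -> : hj_numden [:: a, b & s] =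
  (a%:Z * (hj_numden (b :: s)).1 - (hj_numden (b :: s)).2,
   (hj_numden (b :: s)).1) by [].
move: (hj_frac (b :: s)) (hj_numden (b :: s)) h1 h2 => f N h1 h2.
rewrite !mulr1n => fE.
have N1 : N.1%:~R != 0 :> rat by rewrite intr_eq0; lia.
have f0 : f != 0 by apply: contra_neq N1 => f0; rewrite -fE f0 mul0r.
have N2 : N.2%:~R = f^-1 * N.1%:~R by rewrite -fE mulKf.
by rewrite rmorphB rmorphM /= mulrBl -N2.
Qed.

(** Two equal fractions in lowest terms with positive denominators have the
    same terms. *)
Lemma hj_numden_frac (p q : nat) s : (0 < q)%N -> (q < p)%N -> coprime p q ->
  all (fun a => (2 <= a)%N) s -> p%:R / (p%:R - q%:R) = hj_frac s ->
  hj_numden s = (p%:Z, p%:Z - q%:Z).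
Proof.
move=> q0 qp cpq hs hf.
have pq0 : (p%:R - q%:R : rat) != 0 by rewrite subr_eq0 eqr_nat; lia.
have := hj_fracE hs; have := hj_numden_bounds hs; have := hj_numden_coprime s.
rewrite -hf; case: s hs hf => [|a s] hs hf.
  by move: hf => /= /eqP; rewrite mulf_eq0 invr_eq0 (negPf pq0) pnatr_eq0; lia.
case: (hj_numden _) => N D /=; rewrite mulr1n => coND [D0 DN] /eqP.
rewrite mulrAC (can2_eq (divfK pq0) (mulfK pq0)) => /eqP E.
have {}E : p%:Z * D = N * (p%:Z - q%:Z).
  by apply/eqP; rewrite -(eqr_int rat) !rmorphM rmorphB /= E.
have coP : coprimez p (p%:Z - q%:Z).
  by rewrite /coprimez gcdzDl gcdzN.
have Np : N = p%:Z.
  have d1 : (N %| p%:Z)%Z by rewrite -(Gauss_dvdzl _ coND) E dvdz_mulr.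
  have d2 : (p%:Z %| N)%Z by rewrite -(Gauss_dvdzl _ coP) -E dvdz_mulr.
  have : `|N|%N == p.
    by rewrite eqn_dvd; apply/andP; split; [exact: d1|exact: d2].
  lia.
have p0 : p%:Z != 0 by lia.
by move: E; rewrite Np => /(mulfI p0) ->.
Qed.

Lemma det2_mulrnr u v n : det2 u (v *+ n) = det2 u v *+ n.
Proof. by rewrite /det2 fst_mulrn snd_mulrn; ring. Qed.

Lemma det2_sumr (I : Type) (r : seq I) (P : pred I) u (F : I -> lattice) :
  det2 u (\sum_(i <- r | P i) F i) = \sum_(i <- r | P i) det2 u (F i).
Proof. by rewrite /det2 fst_sum snd_sum !mulr_sumr sumrB. Qed.

Lemma det2_hj_gen s i : det2 (hj_gen s i) (hj_gen s i.+1) = 1.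
Proof.
elim: i => [|i IHi]; first by rewrite /det2 /=; ring.
by rewrite -[RHS]IHi hj_genSS /det2 /= fst_mulrn snd_mulrn; ring.
Qed.

Lemma hj_gen_neq0 s i : hj_gen s i != 0.
Proof.
apply/eqP => g0; have := det2_hj_gen s i.
by rewrite g0 /det2 /= !mul0r subrr.
Qed.

Lemma hj_gen_snd s i : all (fun a => (2 <= a)%N) s -> (i <= size s)%N ->
  0 <= (hj_gen s i).2 < (hj_gen s i.+1).2.
Proof.
move=> hs; elim: i => [|i IHi] // iS.
have {IHi} := IHi (ltnW iS); have := all_nthP 0%N hs _ iS.
rewrite hj_genSS /= snd_mulrn; set a := nth _ _ _.
set x := (hj_gen s i).2; set y := (hj_gen s i.+1).2; nia.
Qed.

(** The recursions of the generators and of the continued fraction compensate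
    each other, so that the combination does not depend on [i]. At [i = size s]
    it is the last generator. *)
Lemma hj_gen_comb s i : (i <= size s)%N ->
  let: (N, D) := hj_numden (drop i s) in
  (hj_gen s i.+1).1 * N - (hj_gen s i).1 * D =
    (hj_numden s).1 - (hj_numden s).2 /\
  (hj_gen s i.+1).2 * N - (hj_gen s i).2 * D = (hj_numden s).1.
Proof.
elim: i => [_|i IHi iS].
  by rewrite drop0; case: (hj_numden s) => N D /=; split; ring.
have := IHi (ltnW iS); rewrite (drop_nth 0%N iS) hj_genSS.
rewrite [hj_numden (_ :: _)]/=; case: (hj_numden _) => N D /= [<- <-].
by rewrite fst_mulrn snd_mulrn; split; ring.
Qed.

Lemma hj_gen_last s :
  hj_gen s (size s).+1 = ((hj_numden s).1 - (hj_numden s).2, (hj_numden s).1).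
Proof.
have := hj_gen_comb (leqnn (size s)); rewrite drop_size.
move=> [<- <-]; rewrite !mulr1 !mulr0 !subr0.
by rewrite -surjective_pairing.
Qed.

Lemma det2_hj_gen_last s i : (i <= size s)%N ->
  det2 (hj_gen s i) (hj_gen s (size s).+1) = (hj_numden (drop i s)).1.
Proof.
move=> iS; rewrite hj_gen_last; have := hj_gen_comb iS.
case: (hj_numden (drop i s)) => N D [<- <-].
rewrite -[RHS]mulr1 -(det2_hj_gen s i) /det2.
by move: (hj_gen s i) (hj_gen s i.+1) => x y /=; ring.
Qed.

(** The determinants of the generators with [v] start nonnegative and end
    nonpositive, so [v] lies between two consecutive generators. These form a
    basis of the lattice, and the coefficients of [v] in it, given by Cramer's
    rule, are nonnegative. *)
Lemma hj_gen_span s (v : lattice) :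
  0 <= v.2 -> 0 <= det2 v (hj_gen s (size s).+1) ->
  exists k : 'I_(size s).+2 -> nat,
    v = \sum_(i < (size s).+2) hj_gen s i *+ k i.
Proof.
move=> v2 vn.
have [i iS [ai bi]] : exists2 i, (i < (size s).+1)%N &
    0 <= det2 (hj_gen s i) v /\ 0 <= det2 v (hj_gen s i.+1).
  pose P i := 0 <= det2 v (hj_gen s i.+1).
  have exP : exists i, P i by exists (size s).
  exists (ex_minn exP); case: ex_minnP => i Pi mini; first exact: mini.
  split=> //; case: i Pi mini => [|i] Pi mini; first by rewrite /det2 /=; lia.
  have [/ltW/mini|] := ltP 0 (det2 v (hj_gen s i.+1)); first by rewrite ltnn.
  by rewrite /det2; lia.
have := det2_hj_gen s i; move: {vn} (hj_gen s) ai bi => G ai bi D.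
pose a := `|det2 v (G i.+1)|%N; pose b := `|det2 (G i) v|%N.
exists (fun j =>
  if j == i :> nat then a else if j == i.+1 :> nat then b else 0)%N.
have iS1 : (i.+1 < (size s).+2)%N by [].
have iS2 : (i < (size s).+2)%N by exact: ltnW.
rewrite (bigD1 (Ordinal iS2)) //= eqxx (bigD1 (Ordinal iS1)) /=; last first.
  by rewrite -val_eqE /= gtn_eqF.
rewrite gtn_eqF // eqxx big1 ?addr0; last first.
  move=> j /andP[]; rewrite -!val_eqE /= => /negPf-> /negPf->.
  by rewrite mulr0n.
rewrite /a /b; move: ai bi D; rewrite /det2.
move: (G i) (G i.+1) => x y a0 b0 D.
apply/eqP; rewrite -pair_eqE /pair_eq /= !fst_mulrn !snd_mulrn.
rewrite !pmulrn !mulrzz !gez0_abs //; apply/andP; split; apply/eqP.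
  by rewrite -[LHS]mulr1 -D; ring.
by rewrite -[LHS]mulr1 -D; ring.
Qed.

(** The [j]-th generator spans an edge of the cone: the linear form [det2 e]
    supports the cone along this edge. *)
Definition extreme_ray s (j : 'I_(size s).+2) :=
  exists e : lattice, det2 e (hj_gen s j) = 0 /\
    forall i : 'I_(size s).+2, i != j -> 0 < det2 e (hj_gen s i).

(** Applying the supporting form to both sides, the right-hand side becomes a
    sum of nonnegative terms with sum 0. *)
Lemma extreme_rayP s j (k : 'I_(size s).+2 -> nat) m : extreme_ray j ->
  hj_gen s j *+ m = \sum_(i < (size s).+2) hj_gen s i *+ k i ->
  forall i, k i = if i == j then m else 0%N.
Proof.
move=> [e [ej ei]] mE.
have kz i : i != j -> k i = 0%N.
  move=> ij; have /eqP := congr1 (det2 e) mE.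
  rewrite det2_mulrnr ej mul0rn det2_sumr eq_sym psumr_eq0; last first.
    move=> l _; rewrite det2_mulrnr mulrn_wge0 //.
    by have [->|/ei/ltW //] := eqVneq l j; rewrite ej.
  move=> /allP/(_ i (mem_index_enum _)) /=.
  by rewrite det2_mulrnr mulrn_eq0 => /orP[/eqP //|]; rewrite gt_eqF ?ei.
move=> i; case: eqP => [->|/eqP/kz //].
move: mE; rewrite (bigD1 j) //= big1; last first.
  by move=> l /kz->; rewrite mulr0n.
by rewrite addr0 => /(mulrn_lattice_inj (hj_gen_neq0 s j)).
Qed.

Lemma extreme_ray_first s :
  all (fun a => (2 <= a)%N) s -> @extreme_ray s ord0.
Proof.
move=> hs; exists (1, 0); split=> [|[[|i] iS] // _].
  by rewrite /det2 /=; ring.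
change (0 < det2 (1, 0) (hj_gen s i.+1)).
have := hj_gen_snd hs (iS : (i <= size s)%N).
by move: (hj_gen s i.+1) (hj_gen s i) => x y; rewrite /det2 /=; lia.
Qed.

Lemma extreme_ray_last s :
  all (fun a => (2 <= a)%N) s -> @extreme_ray s ord_max.
Proof.
move=> hs; exists (- hj_gen s (size s).+1); split=> [|i iS].
  by rewrite /det2 /=; ring.
have iS' : (i <= size s)%N.
  by move: iS; rewrite -val_eqE /=; have := ltn_ord i; lia.
have := det2_hj_gen_last iS'.
have : all (fun a => (2 <= a)%N) (drop i s).
  by apply/allP => x /mem_drop; apply/allP.
move=> /hj_numden_bounds.
move: (hj_gen s i) (hj_gen s _) (hj_numden _) => x y z.
by rewrite /det2 /=; lia.
Qed.

(** * Characters on the orbits *)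

Section TorusCharacter.
Variable F : fieldType.
Implicit Types (x : F) (u v : lattice).

Definition torus_char (x1 x2 : F) v : F := x1 ^ v.1 * x2 ^ v.2.

Variables x1 x2 : F.
Hypotheses (x10 : x1 != 0) (x20 : x2 != 0).

Lemma torus_char0 : torus_char x1 x2 0 = 1.
Proof. by rewrite /torus_char /= !expr0z mulr1. Qed.

Lemma torus_charD u v :
  torus_char x1 x2 (u + v) = torus_char x1 x2 u * torus_char x1 x2 v.
Proof. by rewrite /torus_char /= !expfzDr // mulrACA. Qed.

Lemma torus_char_neq0 v : torus_char x1 x2 v != 0.
Proof. by rewrite mulf_neq0 // expfz_neq0. Qed.

Lemma torus_charMn u n : torus_char x1 x2 (u *+ n) = torus_char x1 x2 u ^+ n.
Proof.
elim: n => [|n IHn]; first by rewrite mulr0n torus_char0 expr0.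
by rewrite mulrS torus_charD IHn exprS.
Qed.

Lemma torus_char_sum (I : Type) (r : seq I) (f : I -> lattice) :
  torus_char x1 x2 (\sum_(i <- r) f i) = \prod_(i <- r) torus_char x1 x2 (f i).
Proof. exact: (big_morph _ torus_charD torus_char0). Qed.

End TorusCharacter.


Lemma sigma_dualP (R : realType) (p q : nat) (y : R * R) :
  sigma_dual p q y -> 0 <= y.2 /\ 0 <= y.1 * p%:R - y.2 * q%:R.
Proof.
move=> yS; split.
  have := yS (0, 1); rewrite /dot mulr0 mulr1 add0r; apply.
  by exists 0, 1; rewrite ler01 lexx scale1r scale0r add0r.
have := yS (p%:R, - q%:R); rewrite /dot mulrN; apply.
by exists 1, 0; rewrite ler01 lexx scale1r scale0r addr0.
Qed.

Lemma S_sigma_ge0 (R : realType) (p q : nat) (v : lattice) :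
  S_sigma R p q v -> 0 <= v.2 /\ 0 <= det2 v (q%:Z, p%:Z).
Proof.
move=> /sigma_dualP[]; rewrite /emb /= ler0z => v2 vpq; split=> //.
by rewrite -(ler0z R) /det2 rmorphB !rmorphM.
Qed.

Lemma mcoeff_sum_eq (R : realType) (g : laurent R) v :
  \sum_(w <- msupp g | w == v) mcoeff w g = mcoeff v g.
Proof.
case: (boolP (v \in msupp g)) => vg.
  rewrite big_mkcond (big_fsetD1 _ vg) /= eqxx big1_fset ?addr0 //= => w.
  by rewrite !inE => /andP[/negPf ->].
rewrite mcoeff_outdom // big_seq_cond big1 // => w /andP[wg /eqP wv].
by rewrite wv (negPf vg) in wg.
Qed.

Section Evaluation.
Variables (R : realType) (s : seq nat).
Notation Cn := ('rV[CC R]_(size s).+2).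

Definition axis_point (j : 'I_(size s).+2) (t : CC R) : Cn :=
  \row_i (if i == j then t else 0).

Definition torus_point (x1 x2 : CC R) : Cn :=
  \row_i torus_char x1 x2 (hj_gen s i).

(** A value of [char_at] is a choice among the values of all representations of
    [v]; it is determined as soon as they agree. *)
Lemma char_at_eq (z : Cn) v (w : CC R) :
  (exists k : 'I_(size s).+2 -> nat,
     v = \sum_(i < (size s).+2) hj_gen s i *+ k i) ->
  (forall k : 'I_(size s).+2 -> nat,
     v = \sum_(i < (size s).+2) hj_gen s i *+ k i ->
     \prod_i z 0 i ^+ k i = w) ->
  char_at z v = w.
Proof.
move=> [k vE] kw; rewrite /char_at; case: xgetP => [_ -> [l [lE ->]]|none].
  exact: kw.
by have := none w; case; exists k; rewrite kw.
Qed.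

Lemma char_at_axis j t m : extreme_ray j ->
  char_at (axis_point j t) (hj_gen s j *+ m) = t ^+ m.
Proof.
move=> ej; apply: char_at_eq => [|k /(extreme_rayP ej) kE].
  exists (fun i => if i == j then m else 0%N); rewrite (bigD1 j) //= eqxx.
  by rewrite big1 ?addr0 // => i /negPf ->.
rewrite (bigD1 j) //= big1 => [|i /negPf ij]; rewrite kE !mxE.
  by rewrite eqxx mulr1.
by rewrite ij expr0.
Qed.

Lemma char_at_axis_eq0 (j : 'I_(size s).+2) t (v : lattice) :
  (forall m, v != hj_gen s j *+ m) ->
  char_at (axis_point j t) v = 0.
Proof.
move=> vj; rewrite /char_at; case: xgetP => // _ -> [k [vE ->]].
have [i ij ki] : exists2 i, i != j & k i != 0%N.
  apply/exists_inP; apply: contraT; rewrite negb_exists_in => /forall_inP kj.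
  have := vj (k j); rewrite {1}vE (bigD1 j) //= big1 ?addr0 ?eqxx // => i ij.
  by have := kj i ij; rewrite negbK => /eqP ->.
apply/eqP/prodf_eq0; exists i => //.
by rewrite mxE (negPf ij) expf_eq0 lt0n ki eqxx.
Qed.

Lemma char_at_torus x1 x2 v : x1 != 0 -> x2 != 0 ->
  (exists k : 'I_(size s).+2 -> nat,
     v = \sum_(i < (size s).+2) hj_gen s i *+ k i) ->
  char_at (torus_point x1 x2) v = torus_char x1 x2 v.
Proof.
move=> x10 x20 vE; apply: char_at_eq => // k ->.
by rewrite torus_char_sum //; apply: eq_bigr => i _; rewrite mxE torus_charMn.
Qed.

Lemma eval_at_axis j (g : laurent R) : extreme_ray j ->
  exists P : {poly CC R}, (forall m, P`_m = mcoeff (hj_gen s j *+ m) g) /\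
    forall t, eval_at g (axis_point j t) = P.[t].
Proof.
move=> ej.
have injm := mulrn_lattice_inj (hj_gen_neq0 s j).
pose c m := mcoeff (hj_gen s j *+ m) g.
have [N cN] : exists N, forall m, (N <= m)%N -> c m = 0.
  (* The m-th multiple of a nonzero vector has a coordinate of modulus >= m. *)
  exists (\max_(v <- msupp g) (`|v.1| + `|v.2|)).+1 => m Nm.
  apply/eqP; rewrite mcoeff_eq0; apply/negP => mg.
  have := @leq_bigmax_seq _ _ xpredT
    (fun v : lattice => `|v.1| + `|v.2|)%N _ mg isT.
  move: Nm (hj_gen_neq0 s j); case: (hj_gen s j) => x y.
  rewrite -!pair_eqE /pair_eq /= !fst_mulrn !snd_mulrn !pmulrn !mulrzz !abszM /=.
  rewrite -mulnDl => Nm xy /leq_ltn_trans/(_ Nm); rewrite ltnNge leq_pmull //.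
  by move: xy; lia.
exists (\poly_(m < N) (c m : CC R)); split=> [m|t].
  by rewrite coef_poly; case: ltnP => // /cN.
rewrite horner_poly.
transitivity (\sum_(v <- msupp g) \sum_(m < N)
    (if v == hj_gen s j *+ m then mcoeff v g else 0) * t ^+ m).
  apply: eq_big_seq => v vg.
  have [[m vE]|vN] := pselect (exists m, v == hj_gen s j *+ m); last first.
    rewrite char_at_axis_eq0 ?mulr0 => [|m]; last first.
      by apply/negP => vm; apply: vN; exists m.
    rewrite big1 // => m _; case: ifP => [vm|_]; last by rewrite mul0r.
    by case: vN; exists m.
  move: vg; rewrite (eqP vE) char_at_axis // => mg.
  have mN : (m < N)%N.
    by rewrite ltnNge; apply/negP => /cN /eqP; rewrite mcoeff_eq0 mg.
  rewrite (bigD1 (Ordinal mN)) //= eqxx big1 ?addr0 // => i.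
  rewrite -val_eqE /= => im; case: eqP => [/injm mi|_]; last by rewrite mul0r.
  by rewrite mi eqxx in im.
rewrite exchange_big; apply: eq_bigr => m _ /=; rewrite -mulr_suml -big_mkcond /=.
by rewrite mcoeff_sum_eq.
Qed.

Lemma eval_at_torus x1 x2 (p q : nat) (g : laurent R) :
  hj_gen s (size s).+1 = (q%:Z, p%:Z) -> poly_fun p q g -> x1 != 0 -> x2 != 0 ->
  eval_at g (torus_point x1 x2) = laurent_eval g x1 x2.
Proof.
move=> hl hg x10 x20; apply: eq_big_seq => v /hg vS; congr (_ * _).
have [v2 vn] := S_sigma_ge0 vS.
by apply: char_at_torus => //; apply: hj_gen_span; rewrite ?hl.
Qed.

End Evaluation.

(** * Derivatives and critical points along the orbits *)

Section Derivatives.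
Variable F : numFieldType.
Implicit Types (x : F).

Lemma is_derive_horner (P : {poly F}) x : is_derive x 1 (horner P) P^`().[x].
Proof.
elim/poly_ind: P => [|P c IHP].
  rewrite deriv0 horner0 (_ : horner 0 = cst 0); first exact: is_derive_cst.
  by apply/funext => t; rewrite horner0.
rewrite (_ : horner _ = horner P * id + cst c); last first.
  by apply/funext => t; rewrite hornerMXaddC.
apply: is_derive_eq.
by rewrite derivMXaddC hornerD hornerMX addr0 [_%:A]mulr1 [_ *: _]mulrC.
Qed.

Lemma near_neq0 x : x != 0 -> \forall t \near x, (t : F) != 0.
Proof.
move=> x0; have : nbhs x (~` [set 0 : F]).
  apply: open_nbhs_nbhs; split; last by apply/eqP.
  apply/closed_openC/accessible_closed_set1/hausdorff_accessible.
  exact: norm_hausdorff.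
by apply: filterS => t /eqP.
Qed.

(** After division by the largest power of the variable, the polynomial does
    not vanish at 0, hence not in a neighbourhood of 0. *)
Lemma near0_horner_neq0 (Q : {poly F}) : Q != 0 ->
  \forall t \near (0 : F), t != 0 -> Q.[t] != 0.
Proof.
move=> Q0; have [m [P P0 QE]] := multiplicity_XsubC Q 0.
move: P0; rewrite Q0 implyTb => P0.
have Pc : {for (0 : F), continuous (horner P)}.
  apply/differentiable_continuous/derivable1_diffP.
  by have [] := is_derive_horner P (0 : F).
have nP : \forall t \near (0 : F), P.[t] != 0 by exact: (Pc _ (near_neq0 P0)).
apply: filterS nP => t Pt t0.
by rewrite QE hornerM horner_exp hornerXsubC subr0 mulf_neq0 // expf_neq0.
Qed.

Lemma near0_coord_horner n (j : 'I_n.+1) (Q : {poly F}) : Q != 0 ->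
  \forall z \near (0 : 'rV[F]_n.+1),
    (z : 'rV[F]_n.+1) 0 j != 0 -> Q.[(z : 'rV[F]_n.+1) 0 j] != 0.
Proof.
move=> Q0.
have zj : (z : 'rV[F]_n.+1) 0 j @[z --> (0 : 'rV[F]_n.+1)] --> (0 : F).
  have := @coord_continuous _ 1 n.+1 0 j (0 : 'rV[F]_n.+1).
  by rewrite /continuous_at mxE.
exact: (zj _ (near0_horner_neq0 Q0)).
Qed.

Lemma ray_meets_nbhs (W : normedModType F) (w : W) (V : set W) :
  nbhs (0 : W) V -> exists2 t : F, t != 0 & V (t *: w).
Proof.
move=> /(near0Z w) Vw; near (0 : F)^' => t; exists t.
  by near: t; exact: nbhs_dnbhs_neq.
by near: t; exact: nbhs_dnbhs.
Unshelve. all: by end_near. Qed.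

(** Writing the derivative with the factor [x^-1], instead of an exponent
    [n - 1], turns the derivatives of Laurent polynomials into Euler operators,
    on which the face argument is linear. *)
Lemma is_derive_exprz (n : int) x : x != 0 ->
  is_derive x 1 (fun t : F => t ^ n) (x^-1 * (n%:~R * x ^ n)).
Proof.
move=> x0.
have natcase m : is_derive x 1 (fun t : F => t ^+ m) (x^-1 * (m%:R * x ^+ m)).
  rewrite (_ : (fun t => _) = horner 'X^m); last first.
    by apply/funext => t; rewrite hornerXn.
  apply: is_derive_eq; first exact: is_derive_horner.
  rewrite derivXn hornerMn hornerXn -mulr_natl; case: m => [|m] /=.
    by rewrite !mul0r mulr0.
  by rewrite exprS mulrCA mulKf.
case: n => m; first exact: natcase.
rewrite NegzE.
have xm0 : x ^+ m.+1 != 0 by rewrite expf_neq0.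
rewrite (_ : (fun t : F => t ^ (- m.+1%:Z)) = fun t => (t ^+ m.+1)^-1); last first.
  by apply/funext => t; rewrite -exprnN.
have [dm vm] := natcase m.+1.
apply: DeriveDef; first exact: derivableV.
rewrite deriveV // vm -exprnN mulrNz -pmulrn.
move: (x ^+ m.+1) (m.+1%:R) xm0 => y k y0.
transitivity (- y ^- 2 * (x^-1 * (k * y))); first by [].
by field; rewrite x0 y0.
Qed.

Lemma derivable_exprzMr (n : int) (b : F) x : x != 0 ->
  derivable (fun t : F => t ^ n * b) x 1.
Proof.
move=> /(is_derive_exprz n)[d _].
exact: (derivableM d (derivable_cst b x 1)).
Qed.

Lemma derivable_exprzMl (n : int) (b : F) x : x != 0 ->
  derivable (fun t : F => b * t ^ n) x 1.
Proof.
move=> /(is_derive_exprz n)[d _].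
exact: (derivableM (derivable_cst b x 1) d).
Qed.

Lemma is_derive_sum_seq (I : Type) (r : seq I) (f : I -> F -> F)
    (df : I -> F) x :
  (forall i, is_derive x 1 (f i) (df i)) ->
  is_derive x 1 (fun t => \sum_(i <- r) f i t) (\sum_(i <- r) df i).
Proof.
move=> fd; elim: r => [|i r IHr].
  rewrite big_nil (_ : (fun t => _) = cst 0); first exact: is_derive_cst.
  by apply/funext => t; rewrite big_nil.
rewrite big_cons (_ : (fun t => _) = f i + fun t => \sum_(j <- r) f j t).
  exact: is_deriveD.
by apply/funext => t; rewrite big_cons.
Qed.

Lemma is_derive_laurent_sum (I : Type) (r : seq I) (a b : I -> F)
    (n : I -> int) x : x != 0 ->
  is_derive x 1 (fun t => \sum_(i <- r) a i * (t ^ n i * b i))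
    (x^-1 * \sum_(i <- r) a i * ((n i)%:~R * (x ^ n i * b i))).
Proof.
move=> x0; rewrite mulr_sumr; apply: is_derive_sum_seq => i.
rewrite (_ : (fun t => _) = (a i * b i) \*: (fun t : F => t ^ n i)); last first.
  by apply/funext => t /=; rewrite [RHS]mulrAC -mulrA.
have dn := is_derive_exprz (n i) x0; apply: is_derive_eq.
transitivity (a i * b i * (x^-1 * ((n i)%:~R * x ^ n i))); first by [].
by ring.
Qed.

Lemma derive1_val (f : F -> F) (x d : F) :
  is_derive x 1 f d -> derive1 f x = d.
Proof. by move=> [_ <-]; rewrite derive1E. Qed.

Lemma derivable_row n (f : 'I_n -> F -> F) x :
  (forall i, derivable (f i) x 1) ->
  derivable (fun t : F => \row_i f i t : 'rV[F]_n) x 1.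
Proof.
move=> fd; rewrite (_ : (fun t => _) =
    \sum_(i < n) (fun t => f i t *: delta_mx 0 i : 'rV[F]_n)); last first.
  apply/funext => t; rewrite fct_sumE [LHS]row_sum_delta.
  by apply: eq_bigr => i _; rewrite mxE.
apply: derivable_sum => i; apply/derivable1_diffP.
by apply: differentiableZl; apply/derivable1_diffP.
Qed.

End Derivatives.

Section Shift.
Variables (F : numFieldType) (V W : normedModType F).

Lemma derivable_shift0 (f : V -> W) (x v : V) :
  derivable f x v <-> derivable (fun t => f (x + t)) 0 v.
Proof.
rewrite /derivable (_ : (fun h => h^-1 *: ((_ \o shift 0) _ - _)) =
  fun h => h^-1 *: ((f \o shift x) (h *: v) - f x)) //.
by apply/funext => h /=; rewrite !addr0 [x + _]addrC.
Qed.

Lemma is_derive_shift0 (f : V -> W) (x v : V) (d : W) :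
  is_derive x v f d -> is_derive 0 v (fun t => f (x + t)) d.
Proof.
move=> [fd <-]; apply: DeriveDef; first exact: (derivable_shift0 f x v).1 fd.
rewrite /derive (_ : (fun h => h^-1 *: ((_ \o shift 0) _ - _)) =
  fun h => h^-1 *: ((f \o shift x) (h *: v) - f x)) //.
by apply/funext => h /=; rewrite !addr0 [x + _]addrC.
Qed.

End Shift.

Section Critical.
Variables (R : realType) (s : seq nat).
Notation Cn := ('rV[CC R]_(size s).+2).

Lemma crit_locus_cst (f : Cn -> CC R) (T : set Cn) (a : CC R) z :
  (forall z, T z -> f z = a) -> T z -> crit_locus f T z.
Proof.
move=> fa Tz; split=> // c _ cT.
apply: (near_eq_is_derive (f := cst a)).
by apply: filterS cT => t [Tct _] /=; rewrite fa.
Qed.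

(** Critical points are tested on curves at time 0. After a translation in
    time, a curve may be parametrized by a coordinate of the orbit instead. *)
Lemma crit_locus_curve (f : Cn -> CC R) (T : set Cn) (x d : CC R)
    (c : CC R -> Cn) (h : CC R -> CC R) :
  crit_locus f T (c x) ->
  (\forall t \near x, [/\ T (c t), derivable c t 1 & f (c t) = h t]) ->
  is_derive x 1 h d -> d = 0.
Proof.
move=> [_ crit] cT hd.
have {}cT : \forall t \near (0 : CC R),
    [/\ T (c (x + t)), derivable c (x + t) 1 & f (c (x + t)) = h (x + t)].
  move: cT; rewrite (near_shift 0); apply: filterS => t /=.
  by rewrite subr0 [t + _]addrC.
have cd : is_derive (0 : CC R) 1 (f \o (fun t => c (x + t))) 0.
  apply: crit; first by rewrite addr0.
  apply: filterS cT => t [Tc cd _]; split; first exact: Tc.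
  apply: (derivable_shift0 (fun t => c (x + t)) t 1).2.
  rewrite (_ : (fun u => _) = fun u => c (x + t + u)).
    exact: (derivable_shift0 c (x + t) 1).1 cd.
  by apply/funext => u; rewrite addrA.
have {}hd : is_derive (0 : CC R) 1 (fun t => h (x + t)) d.
  exact: is_derive_shift0.
have {}cd : is_derive (0 : CC R) 1 (fun t => h (x + t)) 0.
  by apply: near_eq_is_derive cd; apply: filterS cT => t [].
by have [_ <-] := hd; have [_ ->] := cd.
Qed.

Lemma axis_pointE j t : axis_point j t = t *: delta_mx 0 j :> Cn.
Proof.
by apply/rowP => i; rewrite !mxE eqxx mulr_natr mulrb.
Qed.

Lemma axis_point_neq0 j t : t != 0 -> axis_point j t != 0 :> Cn.
Proof.
apply: contra_neq => /rowP/(_ j); rewrite !mxE eqxx; exact.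
Qed.

Lemma crit_axis j (g : laurent R) (T : set Cn) (P : {poly CC R}) (t0 : CC R) :
  (forall t, eval_at g (axis_point j t) = P.[t]) ->
  (forall t, t != 0 -> T (axis_point j t)) ->
  t0 != 0 -> crit_locus (eval_at g) T (axis_point j t0) -> P^`().[t0] = 0.
Proof.
move=> gP jT t00 crit.
apply: (crit_locus_curve (h := horner P) crit); last exact: is_derive_horner.
apply: filterS (near_neq0 t00) => t tn0; split; [exact: jT| |exact: gP].
apply: derivable_row => i; case: eqP => _; first exact: derivable_id.
exact: derivable_cst.
Qed.

(** For [e = fst] and [e = snd] this is the value of the Euler operators
    [x1 d/dx1] and [x2 d/dx2] on [f]. *)
Definition laurent_theta (f : laurent R) (e : lattice -> int) (x1 x2 : CC R) :=
  \sum_(v <- msupp f) (mcoeff v f : CC R) * ((e v)%:~R * torus_char x1 x2 v).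

Lemma is_derive_laurent1 (f : laurent R) (x1 x2 : CC R) : x1 != 0 ->
  is_derive x1 1 (fun t : CC R => laurent_eval f t x2)
    (x1^-1 * laurent_theta f fst x1 x2).
Proof. by move=> x10; exact: is_derive_laurent_sum. Qed.

Lemma is_derive_laurent2 (f : laurent R) (x1 x2 : CC R) : x2 != 0 ->
  is_derive x2 1 (fun t : CC R => laurent_eval f x1 t)
    (x2^-1 * laurent_theta f snd x1 x2).
Proof.
move=> x20.
have -> : laurent_theta f snd x1 x2 =
    \sum_(v <- msupp f) (mcoeff v f : CC R) * (v.2%:~R * (x2 ^ v.2 * x1 ^ v.1)).
  by apply: eq_bigr => v _; rewrite [x2 ^ _ * _]mulrC.
rewrite (_ : (fun t => _) = fun t : CC R =>
    \sum_(v <- msupp f) (mcoeff v f : CC R) * (t ^ v.2 * x1 ^ v.1)).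
  exact: is_derive_laurent_sum.
by apply/funext => t; apply: eq_bigr => v _; rewrite [t ^ _ * _]mulrC.
Qed.

Lemma crit_torus (g : laurent R) (T : set Cn) (x1 x2 : CC R) :
  (forall x1 x2, x1 != 0 -> x2 != 0 ->
     eval_at g (torus_point s x1 x2) = laurent_eval g x1 x2) ->
  (forall x1 x2 : CC R, x1 != 0 -> x2 != 0 -> T (torus_point s x1 x2)) ->
  x1 != 0 -> x2 != 0 -> crit_locus (eval_at g) T (torus_point s x1 x2) ->
  laurent_theta g fst x1 x2 = 0 /\ laurent_theta g snd x1 x2 = 0.
Proof.
move=> gE hT x10 x20 crit; split.
- suff /eqP : x1^-1 * laurent_theta g fst x1 x2 = 0.
    by rewrite mulf_eq0 invr_eq0 (negPf x10) => /eqP.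
  apply: (crit_locus_curve (c := fun t => torus_point s t x2)
    (h := fun t => laurent_eval g t x2) crit); last exact: is_derive_laurent1.
  apply: filterS (near_neq0 x10) => t tn0; split; [exact: hT| |exact: gE].
  apply: derivable_row => i; rewrite /torus_char.
  exact: derivable_exprzMr.
- suff /eqP : x2^-1 * laurent_theta g snd x1 x2 = 0.
    by rewrite mulf_eq0 invr_eq0 (negPf x20) => /eqP.
  apply: (crit_locus_curve (c := fun t => torus_point s x1 t)
    (h := fun t => laurent_eval g x1 t) crit); last exact: is_derive_laurent2.
  apply: filterS (near_neq0 x20) => t tn0; split; [exact: hT| |exact: gE].
  apply: derivable_row => i; rewrite /torus_char.
  exact: derivable_exprzMl.
Qed.

End Critical.

(** * Compact faces of the Newton polyhedron *)

Lemma seq_argmin (T : eqType) d (O : orderType d) (f : T -> O) (s : seq T) x0 :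
  x0 \in s -> exists2 a, a \in s & forall x, x \in s -> (f a <= f x)%O.
Proof.
elim: s x0 => // y [|z s] IHs x0 _.
  by exists y; rewrite ?mem_head // => x; rewrite inE => /eqP ->.
have [a sa amin] := IHs z (mem_head _ _).
have [ya|ay] := leP (f y) (f a).
  exists y; rewrite ?mem_head // => x; rewrite inE => /predU1P[-> //|/amin].
  exact: le_trans.
exists a; first by rewrite inE sa orbT.
by move=> x; rewrite inE => /predU1P[->|/amin //]; exact: ltW.
Qed.

Lemma dotDZr (R : realType) (w x y : R * R) (a b : R) :
  dot w (a *: x + b *: y) = a * dot w x + b * dot w y.
Proof.
rewrite /dot; case: w x y => w1 w2 [x1 x2] [y1 y2].
change (w1 * (a * x1 + b * y1) + w2 * (a * x2 + b * y2) =
  a * (w1 * x1 + w2 * x2) + b * (w1 * y1 + w2 * y2)); ring.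
Qed.

Lemma dotD (R : realType) (w x y : R * R) : dot w (x + y) = dot w x + dot w y.
Proof. by have := dotDZr w x y 1 1; rewrite !scale1r !mul1r. Qed.

Section NewtonFace.
Variables (R : realType) (p q : nat).
Implicit Types (x y w : R * R) (g : laurent R) (u v : lattice).

Lemma convE x y (k : {i01 R}) :
  conv k (x : convex_lmodType (R * R)%type) y = k%:num *: x + (1 - k%:num) *: y.
Proof. by []. Qed.

Lemma convex_newton g :
  convex_set (newton p q g : set (convex_lmodType (R * R)%type)).
Proof.
move=> x y k; rewrite !inE => Nx Ny A [cA GA].
have := cA x y k; rewrite !inE; apply; [exact: Nx|exact: Ny].
Qed.

Lemma newton_emb g v : v \in msupp g -> newton p q g (emb R v).
Proof.
move=> vg; apply: sub_gen_smallest; exists v => //; exists 0; last exact: addr0.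
by move=> u _; rewrite /dot /= !mul0r addr0.
Qed.

Variable u : lattice.
(** [dot w] extends the weight [det2 u] to the plane, and [dot l] is a
    coordinate along its level lines. *)
Let w : R * R := (- u.2%:~R, u.1%:~R).
Let l : R * R := (u.1%:~R, u.2%:~R).

Hypotheses (u1 : 0 < det2 u (1, 0)) (un : 0 < det2 u (q%:Z, p%:Z)).
Hypothesis (p0 : (0 < p)%N).

Lemma dot_emb v : dot w (emb R v) = (det2 u v)%:~R.
Proof. by rewrite /dot /det2 /= rmorphB !rmorphM /=; ring. Qed.

(** Every point of the dual cone is a nonnegative combination of its two edge
    generators, and the weight is positive on both of them. *)
Lemma sigma_dual_weight y :
  sigma_dual p q y -> 0 <= dot w y /\ (dot w y = 0 -> y = 0).
Proof.
move=> /sigma_dualP[y2 ypq].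
have pR : 0 < p%:R :> R by rewrite ltr0n.
have a0 : 0 < - u.2%:~R :> R.
  by rewrite -rmorphN ltr0z; move: u1; rewrite /det2 /=; lia.
have b0 : 0 < u.1%:~R * p%:R - u.2%:~R * q%:R :> R.
  move: un; rewrite -(ltr0z R) /det2 /= rmorphB !rmorphM /=; exact.
have E : dot w y * p%:R = - u.2%:~R * (y.1 * p%:R - y.2 * q%:R) +
    y.2 * (u.1%:~R * p%:R - u.2%:~R * q%:R) by rewrite /dot /w /=; ring.
split; first by rewrite -(pmulr_lge0 _ pR) E addr_ge0 // mulr_ge0 // ltW.
move=> w0; move: E; rewrite w0 mul0r => /esym/eqP.
rewrite paddr_eq0 ?mulr_ge0 ?(ltW a0) ?(ltW b0) // !mulf_eq0.
rewrite (gt_eqF a0) (gt_eqF b0) orbF /= => /andP[/eqP E1 /eqP E2].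
move: E1; rewrite E2 mul0r subr0 => /eqP.
rewrite mulf_eq0 (gt_eqF pR) orbF => /eqP E1.
by rewrite (surjective_pairing y) E1 E2.
Qed.

(** [w] and [l] are orthogonal and nonzero. *)
Lemma dot_inj x y : dot w x = dot w y -> dot l x = dot l y -> x = y.
Proof.
move=> Ew El.
have u20 : u.2%:~R != 0 :> R.
  by rewrite intr_eq0; move: u1; rewrite /det2 /=; lia.
have N0 : u.1%:~R * u.1%:~R + u.2%:~R * u.2%:~R != 0 :> R.
  by rewrite gt_eqF // ltr_wpDl -?expr2 ?sqr_ge0 // exprn_even_gt0.
have [z1 z2] : (forall z, z.1 * (u.1%:~R * u.1%:~R + u.2%:~R * u.2%:~R) =
    u.1%:~R * dot l z - u.2%:~R * dot w z) /\
    (forall z, z.2 * (u.1%:~R * u.1%:~R + u.2%:~R * u.2%:~R) =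
    u.2%:~R * dot l z + u.1%:~R * dot w z).
  by split=> z; rewrite /dot /w /l /=; ring.
rewrite (surjective_pairing x) (surjective_pairing y).
by congr (_, _); apply: (mulIf N0); rewrite ?z1 ?z2 Ew El.
Qed.

(** The open half-plane above a line together with a segment of this line
    encloses the Newton polyhedron when the segment is the expected face. *)
Lemma convex_strip (d m M : R) :
  convex_set ([set x | d < dot w x \/
      [/\ dot w x = d, m <= dot l x & dot l x <= M]]
    : set (convex_lmodType (R * R)%type)).
Proof.
apply/convex_setW => x y; rewrite !inE => Cx Cy k k0 k1; rewrite inE /= convE.
have k1' : 0 < 1 - k%:num by rewrite subr_gt0.
rewrite !dotDZr; case: Cx => [dx|[dx mx Mx]].
  left; have {Cy} dy : d <= dot w y by case: Cy => [/ltW|[->]].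
  nra.
by case: Cy => [dy|[dy my My]]; [left; nra|right; split; nra].
Qed.

Lemma compact_segment_plane x y :
  compact [set (1 - t) *: x + t *: y | t in `[0, 1]%classic].
Proof.
apply: continuous_compact; last exact: segment_compact.
apply: continuous_subspaceT => t.
rewrite (_ : (fun t => _) = fun t : R => x + t *: (y - x)); last first.
  by apply/funext => r; rewrite scalerBl scale1r scalerBr addrAC addrA.
apply: (@cvgD R (R * R)%type); first exact: cvg_cst.
exact: scalel_continuous.
Qed.

(** The weight is positive on the nonzero vectors of the cone, so only the
    exponents of least weight contribute to the face: it is the segment between
    the two outermost of them. *)
Lemma newton_face g (d : int) (v0 : lattice) :
  (forall v, v \in msupp g -> d <= det2 u v) ->
  v0 \in msupp g -> det2 u v0 = d ->
  exists F, [/\ is_face (newton p q g) F, compact F &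
    forall v, v \in msupp g -> F (emb R v) <-> det2 u v = d].
Proof.
move=> dmin v0g v0d.
pose A := [seq v <- msupp g | det2 u v == d].
have v0A : v0 \in A by rewrite mem_filter v0d eqxx v0g.
have [a aA amin] := seq_argmin (fun v => dot l (emb R v)) v0A.
have [b bA bmax] := seq_argmin (fun v => - dot l (emb R v)) v0A.
have Ag v : v \in A -> v \in msupp g /\ det2 u v = d.
  by rewrite mem_filter => /andP[/eqP ? ?].
have [ag ad] := Ag _ aA; have [bg bd] := Ag _ bA.
pose C : set (R * R) := [set x | d%:~R < dot w x \/
  [/\ dot w x = d%:~R, dot l (emb R a) <= dot l x &
      dot l x <= dot l (emb R b)]].
have convC : convex_set (C : set (convex_lmodType (R * R)%type)).
  exact: convex_strip.
have NC : newton p q g `<=` C.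
  apply: smallest_sub; first exact: convC.
  move=> _ [v /= vg] [y yS <-].
  have [wy0 wyE] := sigma_dual_weight yS.
  have dE : dot w (emb R v + y) = (det2 u v)%:~R + dot w y.
    by rewrite dotD dot_emb.
  have [y0|/negP y0] := eqVneq y 0.
    rewrite y0 addr0; have := dmin _ vg; rewrite le_eqVlt => /predU1P[dv|dv].
      have vA : v \in A by rewrite mem_filter -dv eqxx.
      right; rewrite dot_emb -dv; split=> //; first exact: amin.
      by rewrite -lerN2 bmax.
    by left; rewrite dot_emb ltr_int.
  left; rewrite dE addrC ltr_pwDl ?ler_int ?dmin //.
  rewrite lt_neqAle wy0 andbT eq_sym; apply/eqP => /wyE/eqP; exact: y0.
pose F : set (R * R) :=
  [set x | newton p q g x /\ forall y, newton p q g y -> dot w x <= dot w y].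
have wd x : newton p q g x -> d%:~R <= dot w x.
  by move=> /NC[/ltW //|[-> _ _]].
have Fd x : newton p q g x -> F x <-> dot w x = d%:~R.
  move=> Nx; split=> [[_ /(_ _ (newton_emb v0g))]|xd].
    by rewrite dot_emb v0d => xd; apply/eqP; rewrite eq_le xd wd.
  by split=> // y /wd; rewrite xd.
exists F; split.
- split; last by exists w.
  by exists (emb R v0); apply/(Fd _ (newton_emb v0g)); rewrite dot_emb v0d.
- rewrite (_ : F =
      [set (1 - t) *: emb R a + t *: emb R b | t in `[0, 1]%classic]).
    exact: compact_segment_plane.
  apply/seteqP; split=> [x [Nx xF]|_ [t /= t01 <-]].
    have xd : dot w x = d%:~R by apply/(Fd _ Nx).
    have [ax xb] : dot l (emb R a) <= dot l x /\ dot l x <= dot l (emb R b).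
      by case: (NC _ Nx) => [|[]//]; rewrite xd ltxx.
    have [ab|ab] := eqVneq (dot l (emb R a)) (dot l (emb R b)).
      exists 0; first by rewrite /= in_itv /= lexx ler01.
      rewrite subr0 scale1r scale0r addr0.
      apply: dot_inj; first by rewrite xd dot_emb ad.
      by apply/eqP; rewrite eq_le ax ab xb.
    have ba : 0 < dot l (emb R b) - dot l (emb R a).
      by rewrite subr_gt0 lt_neqAle ab (le_trans ax).
    pose t := (dot l x - dot l (emb R a)) /
      (dot l (emb R b) - dot l (emb R a)).
    have t0 : 0 <= t by rewrite divr_ge0 ?(ltW ba) // subr_ge0.
    have t1 : t <= 1 by rewrite ler_pdivrMr // mul1r lerD2r.
    exists t; first by rewrite /= in_itv /= t0 t1.
    apply: dot_inj; rewrite dotDZr; first by rewrite !dot_emb ad bd xd; ring.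
    by rewrite /t; field; rewrite gt_eqF.
  have Nt : newton p q g ((1 - t) *: emb R a + t *: emb R b).
    have [t0 t1] : 0 <= t /\ t <= 1 by move: t01; rewrite in_itv /= => /andP.
    have := @convex_newton g (emb R b) (emb R a) (Itv01 t0 t1).
    by rewrite convE /= !inE addrC; apply; apply: newton_emb.
  by apply/(Fd _ Nt); rewrite dotDZr !dot_emb ad bd; ring.
- move=> v vg; rewrite (Fd _ (newton_emb vg)) dot_emb.
  by split=> [/eqP|->//]; rewrite eqr_int => /eqP.
Qed.

End NewtonFace.

(** * Limits of characters along an ultrafilter *)

Section FieldLimits.
Variables (K : numFieldType) (T : Type) (U : set_system T).
Context {FU : ProperFilter U}.
Implicit Types (f g : T -> K) (a b : K).

Lemma cvg_sum_seq (I : eqType) (r : seq I) (f : I -> T -> K) (a : I -> K) :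
  (forall i, i \in r -> f i t @[t --> U] --> a i) ->
  \sum_(i <- r) f i t @[t --> U] --> \sum_(i <- r) a i.
Proof.
elim: r => [|i r IHr] fa.
  rewrite big_nil (_ : (fun t => _) = cst 0); first exact: cvg_cst.
  by apply/funext => t; rewrite big_nil.
rewrite big_cons (_ : (fun t => _) = fun t => f i t + \sum_(j <- r) f j t).
  apply: cvgD; first by apply: fa; rewrite mem_head.
  by apply: IHr => j jr; apply: fa; rewrite inE jr orbT.
by apply/funext => t; rewrite big_cons.
Qed.

Lemma cvg_fun_unique f a b :
  f t @[t --> U] --> a -> f t @[t --> U] --> b -> a = b.
Proof. exact: (cvg_unique (@norm_hausdorff _ K)). Qed.

Lemma cvg_exprn f a n : f t @[t --> U] --> a -> f t ^+ n @[t --> U] --> a ^+ n.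
Proof.
move=> fa; elim: n => [|n IHn].
  by rewrite expr0; apply: cvg_cst.
by rewrite exprS; under eq_fun do rewrite exprS; apply: cvgM.
Qed.

Lemma cvg_exprz f a (n : int) : a != 0 ->
  f t @[t --> U] --> a -> f t ^ n @[t --> U] --> a ^ n.
Proof.
move=> a0 fa; case: n => n; first exact: cvg_exprn.
rewrite NegzE -exprnN; under eq_fun do rewrite -exprnN.
by apply: cvgV; [rewrite expf_neq0 | exact: cvg_exprn].
Qed.

Lemma cvg0_exprn f n : (0 < n)%N ->
  f t @[t --> U] --> 0 -> f t ^+ n @[t --> U] --> 0.
Proof. by move=> n0 f0; have := cvg_exprn (n := n) f0; rewrite expr0n gtn_eqF. Qed.

Lemma cvg0_root f n : (0 < n)%N ->
  f t ^+ n @[t --> U] --> 0 -> f t @[t --> U] --> 0.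
Proof.
move=> n0 /cvgr0Pnorm_lt f0; apply/cvgr0Pnorm_lt => e e0.
have := f0 (e ^+ n) (exprn_gt0 n e0); apply: filterS => t.
by rewrite normrX ltr_pXn2r ?nnegrE // ltW.
Qed.

(** For a nonpositive exponent the powers have modulus at least 1 as soon as
    the modulus of [f] is less than 1. *)
Lemma cvg0_exprz_gt0 f (n : int) : (forall t, f t != 0) ->
  f t @[t --> U] --> 0 -> f t ^ n @[t --> U] --> 0 -> 0 < n.
Proof.
move=> fn0 /cvgr0Pnorm_lt f0 /cvgr0Pnorm_lt fn; rewrite ltNge; apply/negP => nle.
have [t [/= ft1]] := filter_ex (filterI (f0 1 ltr01) (fn 1 ltr01)).
have -> : n = - `|n|%N%:Z by lia.
rewrite -exprnN normfV normrX invf_lt1 ?exprn_gt0 ?normr_gt0 // => /lt_le_trans.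
by move=> /(_ _ (exprn_ile1 _ (normr_ge0 _) (ltW ft1))); rewrite ltxx.
Qed.

End FieldLimits.

Section UltraLimits.
Variables (T : Type) (U : set_system T).
Context {UU : UltraFilter U}.

Lemma ultra_or (A B : set T) : U (A `|` B) -> U A \/ U B.
Proof.
move=> UAB; have [|nA] := in_ultra_setVsetC A UU; [by left|right].
by apply: filterS (filterI UAB nA) => t [[]].
Qed.

(** One of finitely many alternatives holds on a set of the ultrafilter. *)
Lemma ultra_pick (I : eqType) (r : seq I) (P : I -> set T) :
  U [set t | exists2 i, i \in r & P i t] -> exists2 i, i \in r & U (P i).
Proof.
elim: r => [|i r IHr] Ur.
  by have [t []] := filter_ex Ur.
have [|UPi|Ur'] := @ultra_or (P i) [set t | exists2 j, j \in r & P j t].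
- apply: filterS Ur => t [j]; rewrite inE => /predU1P[->|jr] Pj; [by left|right].
  by exists j.
- by exists i => //; rewrite mem_head.
- by have [j jr Uj] := IHr Ur'; exists j => //; rewrite inE jr orbT.
Qed.

(** A cluster point of an ultrafilter is a limit of it. *)
Lemma ultra_compact_cvg (X : topologicalType) (A : set X) (f : T -> X) :
  compact A -> U (f @^-1` A) -> exists l : X, f @ U --> l.
Proof.
move=> cA UA; have [l [_ lc]] := cA (f @ U) _ UA.
exists l => B lB; have [//|nB] := in_ultra_setVsetC (f @^-1` B) UU.
by have [x [/(_ _)]] := lc (~` B) B nB lB.
Qed.

Lemma ultra_complex_cvg (R : realType) (f : T -> CC R) :
  (\forall t \near U, `|f t| <= 1) -> exists l : CC R, f t @[t --> U] --> l.
Proof.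
move=> f1.
have [a fa] : exists a : R, complex.Re (f t) @[t --> U] --> a.
  apply: (@ultra_compact_cvg _ _ _ (@segment_compact R (-1) 1)).
  apply: filterS f1 => t ft; rewrite /= in_itv /= -ler_norml -lecR.
  exact: le_trans (normc_ge_Re _) ft.
have [b fb] : exists b : R, complex.Im (f t) @[t --> U] --> b.
  apply: (@ultra_compact_cvg _ _ _ (@segment_compact R (-1) 1)).
  apply: filterS f1 => t ft; rewrite /= in_itv /= -ler_norml -lecR.
  apply: le_trans ft; rewrite normc_def lecR -sqrtr_sqr.
  by rewrite ler_wsqrtr // lerDr sqr_ge0.
exists (a +i* b)%C; apply/cvgrPdist_lt => e e0.
have e20 : 0 < complex.Re e / 2.
  by move: e0; rewrite ltcE => /andP[_ e0]; rewrite divr_gt0.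
move/cvgrPdist_lt : fa => /(_ _ e20) fa.
move/cvgrPdist_lt : fb => /(_ _ e20) fb.
apply: filterS (filterI fa fb) => t [].
case: (f t) => x y /= ax b_y.
rewrite -(RRe_real (gtr0_real e0)).
move: (complex.Re e) e20 ax b_y => E e20 ax b_y.
change (`|((a - x) +i* (b - y))%C : R[i]| < E%:C%C).
rewrite normc_def /= ltcR.
have E0 : 0 < E by rewrite -(pmulr_lgt0 E (_ : 0 < 2^-1)).
rewrite -(@ltr_pXn2r _ 2) // ?nnegrE ?sqrtr_ge0 ?(ltW E0) //.
rewrite sqr_sqrtr ?addr_ge0 ?sqr_ge0 //.
have sq z : `|z| < E / 2 -> z ^+ 2 < (E / 2) ^+ 2.
  by move=> zE; rewrite -real_normK ?num_real // ltr_pXn2r ?nnegrE ?(ltW e20).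
apply: (lt_trans (ltrD (sq _ ax) (sq _ b_y))).
by rewrite -subr_gt0 (_ : _ - _ = E ^+ 2 / 2) ?divr_gt0 ?exprn_gt0 //; field.
Qed.

End UltraLimits.

(** By Cramer's rule, [v] has coordinates [det2 v m] and [det2 u v] in the
    basis [(u, m)] of the lattice. *)
Lemma torus_char_basis (F : fieldType) (x1 x2 : F) (u m v : lattice) :
  x1 != 0 -> x2 != 0 -> det2 u m = 1 ->
  torus_char x1 x2 v =
    torus_char x1 x2 u ^ det2 v m * torus_char x1 x2 m ^ det2 u v.
Proof.
move=> x10 x20 um; rewrite /torus_char !expfzMl !exprz_exp mulrACA -!expfzDr //.
by congr (_ ^ _ * _ ^ _); rewrite -[LHS]mulr1 -um /det2; ring.
Qed.

(** When [det2 u m = 1], this is the point of the torus where the characters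
    [u] and [m] take the values [b] and 1. *)
Lemma torus_char_dual (F : fieldType) (b : F) (m v : lattice) : b != 0 ->
  torus_char (b ^ m.2) (b ^ (- m.1)) v = b ^ det2 v m.
Proof.
move=> b0; rewrite /torus_char !exprz_exp -expfzDr //.
by congr (_ ^ _); rewrite /det2; ring.
Qed.

Section TorusLimits.
Variables (K : numFieldType) (T : Type) (U : set_system T).
Context {FU : ProperFilter U}.
Variables (x1 x2 : T -> K).
Hypotheses (x10 : forall t, x1 t != 0) (x20 : forall t, x2 t != 0).
Notation chi v := (fun t => torus_char (x1 t) (x2 t) v).
Implicit Types (r : seq lattice) (c : lattice -> K).

(** Divide the relation by the dominant character and pass to the limit. *)
Lemma dominant_coef_eq0 r c v0 : v0 \in r -> uniq r ->
  (forall v, v \in r -> v != v0 -> chi (v - v0) @ U --> (0 : K)) ->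
  (\forall t \near U, \sum_(v <- r) c v * chi v t = 0) -> c v0 = 0.
Proof.
move=> v0r ur dom eq0.
have lim1 : \sum_(v <- r) c v * chi (v - v0) t @[t --> U] -->
    \sum_(v <- r) c v * (v == v0)%:R.
  apply: cvg_sum_seq => v vr; apply: cvgM; first exact: cvg_cst.
  have [->|vv0] := eqVneq v v0; last exact: dom.
  by rewrite subrr; under eq_fun do rewrite torus_char0; exact: cvg_cst.
have lim0 : \sum_(v <- r) c v * chi (v - v0) t @[t --> U] --> (0 : K).
  apply: cvg_near_cst; apply: filterS eq0 => t /= eq0.
  apply: (mulIf (torus_char_neq0 (x10 t) (x20 t) v0)).
  rewrite mul0r -[RHS]eq0 mulr_suml; apply: eq_bigr => v _.
  by rewrite -mulrA -torus_charD // subrK.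
have := @cvg_fun_unique _ _ _ FU _ _ _ lim1 lim0.
rewrite (bigD1_seq v0) //= eqxx mulr1 big1 ?addr0 // => v /negPf ->.
by rewrite mulr0.
Qed.

Variables (u m : lattice) (b : K).
Hypotheses (um : det2 u m = 1) (b0 : b != 0) (ub : chi u @ U --> b).

(** In the basis [(u, m)], the factor of the character [e] that comes from [u]
    has a nonzero limit. *)
Lemma chi_transverse_cvg0 (e : lattice) :
  chi e @ U --> (0 : K) -> chi m t ^ det2 u e @[t --> U] --> (0 : K).
Proof.
move=> e0; have -> : (fun t => chi m t ^ det2 u e) =
    fun t => (chi u t ^ det2 e m)^-1 * chi e t.
  apply/funext => t; rewrite (torus_char_basis e (x10 t) (x20 t) um) mulKf //.
  by rewrite expfz_neq0 // torus_char_neq0.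
rewrite -(mulr0 ((b ^ det2 e m)^-1)); apply: cvgM e0.
by apply: cvgV; [rewrite expfz_neq0|exact: cvg_exprz].
Qed.

Lemma chi_transverse_neq0 (e : lattice) :
  chi e @ U --> (0 : K) -> det2 u e != 0.
Proof.
move=> /chi_transverse_cvg0 e0; apply/eqP => ue.
have : (1 : K) = 0; last by apply/eqP/oner_neq0.
apply: (cvg_fun_unique _ e0).
by rewrite ue; under eq_fun do rewrite expr0z; exact: cvg_cst.
Qed.

Hypotheses (e1 : lattice) (ue1 : 0 < det2 u e1) (e10 : chi e1 @ U --> (0 : K)).

Lemma chi_transverse0 : chi m @ U --> (0 : K).
Proof.
have := chi_transverse_cvg0 e10.
have -> : det2 u e1 = `|det2 u e1|%N by lia.
by apply: cvg0_root; lia.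
Qed.

Lemma chi_transverse_gt0 (e : lattice) :
  chi e @ U --> (0 : K) -> 0 < det2 u e.
Proof.
move=> /chi_transverse_cvg0; apply: cvg0_exprz_gt0 chi_transverse0.
by move=> t; exact: torus_char_neq0.
Qed.

(** After division by the power [d] of the character [m], the terms of weight
    larger than [d] tend to 0 and the others converge to their values at the
    point where the characters [u] and [m] are [b] and 1. *)
Lemma initial_sum_eq0 r c (d : int) : (forall v, v \in r -> d <= det2 u v) ->
  (\forall t \near U, \sum_(v <- r) c v * chi v t = 0) ->
  \sum_(v <- r | det2 u v == d) c v * torus_char (b ^ m.2) (b ^ (- m.1)) v = 0.
Proof.
move=> dmin eq0.
have lim1 : \sum_(v <- r) c v * (chi u t ^ det2 v m * chi m t ^ (det2 u v - d))
    @[t --> U] --> \sum_(v <- r) c v * (b ^ det2 v m * (det2 u v == d)%:R).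
  apply: cvg_sum_seq => v vr; apply: cvgM; first exact: cvg_cst.
  apply: cvgM; first exact: cvg_exprz.
  have [->|vd] := eqVneq (det2 u v) d.
    by rewrite subrr; under eq_fun do rewrite expr0z; exact: cvg_cst.
  have := dmin _ vr; move: vd; rewrite -subr_ge0 -subr_eq0.
  case: (det2 u v - d) => // n n0 _; apply: cvg0_exprn chi_transverse0.
  by rewrite lt0n.
have lim0 : \sum_(v <- r) c v * (chi u t ^ det2 v m * chi m t ^ (det2 u v - d))
    @[t --> U] --> (0 : K).
  apply: cvg_near_cst; apply: filterS eq0 => t /= eq0.
  have mt0 := torus_char_neq0 (x10 t) (x20 t) m.
  apply: (mulIf (expfz_neq0 d mt0)).
  rewrite mul0r -[RHS]eq0 mulr_suml; apply: eq_bigr => v _.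
  rewrite (torus_char_basis v (x10 t) (x20 t) um) -!mulrA -expfzDr //.
  by rewrite subrK.
have := @cvg_fun_unique _ _ _ FU _ _ _ lim1 lim0.
move=> E; rewrite big_mkcond -[RHS]E; apply: eq_bigr => v _.
by rewrite torus_char_dual //; case: eqP; rewrite ?mulr1 ?mulr0.
Qed.

End TorusLimits.

(** Divide [w] by the greatest common divisor of its coordinates; [m] is then
    given by Bezout's relation. *)
Lemma primitive_direction (w : lattice) : w != 0 ->
  exists u m n, [/\ det2 u m = 1, (0 < n)%N & w = u *+ n].
Proof.
case: w => x y; rewrite -pair_eqE /pair_eq /= => xy0.
have [a [b ab]] := Bezoutz x y.
have [x' xE] := dvdzP (dvdz_gcdl x y); have [y' yE] := dvdzP (dvdz_gcdr x y).
have k0 : (0 < gcdn `|x| `|y|)%N.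
  by rewrite lt0n -[_ == _]/(gcdz x y == 0) gcdz_eq0.
have kE : gcdz x y = (gcdn `|x| `|y|)%:Z by [].
rewrite {}kE in ab xE yE; move: (gcdn _ _) k0 ab xE yE => k k0 ab xE yE.
exists (x', y'), (- b, a), k; split=> //.
  have kn0 : k%:Z != 0 by rewrite -lt0n.
  by apply: (mulIf kn0); rewrite mul1r /det2 /= -[RHS]ab xE yE; ring.
apply/eqP; rewrite -pair_eqE /pair_eq /= fst_mulrn snd_mulrn /=.
by rewrite !pmulrn !mulrzz -xE -yE !eqxx.
Qed.

Lemma norm_root_bounds (K : numFieldType) (x e : K) n : (0 < n)%N ->
  e <= `|x ^+ n| -> `|x ^+ n| <= 1 -> e <= `|x| <= 1.
Proof.
move=> n0; rewrite normrX => ex; rewrite expr_le1 // => x1; rewrite x1 andbT.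
by rewrite (le_trans ex) // -[leRHS]expr1 ler_wiXn2l.
Qed.

Lemma det2N (u v : lattice) : det2 (- u) v = - det2 u v.
Proof. by rewrite /det2 /=; ring. Qed.

Lemma det2NN (u v : lattice) : det2 (- u) (- v) = det2 u v.
Proof. by rewrite /det2 /=; ring. Qed.

Lemma torus_charN (F : fieldType) (x1 x2 : F) u :
  torus_char x1 x2 (- u) = (torus_char x1 x2 u)^-1.
Proof. by rewrite /torus_char /= invfM !invr_expz. Qed.

Section Degeneration.
Variables (R : realType) (T : Type) (U : set_system T).
Context {UU : UltraFilter U}.
Variables (x1 x2 : T -> CC R).
Hypotheses (x10 : forall t, x1 t != 0) (x20 : forall t, x2 t != 0).
Notation chi v := (fun t => torus_char (x1 t) (x2 t) v).
Implicit Types (r : seq lattice) (c : lattice -> CC R).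

Lemma dominant_exponent r v : v \in r ->
  exists2 v0, v0 \in r & U [set t | forall w, w \in r -> `|chi (w - v0) t| <= 1].
Proof.
move=> vr; apply: ultra_pick; apply: filterE => t /=.
have [v0 v0r vmax] := seq_argmin (fun w => - complex.Re `|chi w t|) vr.
exists v0 => // w /vmax; rewrite lerN2 => wv0.
have -> : chi (w - v0) t = chi w t / chi v0 t.
  by rewrite torus_charD // torus_charN.
rewrite normrM normfV ler_pdivrMr ?normr_gt0 ?torus_char_neq0 // mul1r.
have absE (z : R[i]) : `|z| = (complex.Re `|z|)%:C%C.
  by rewrite RRe_real // normr_real.
by rewrite absE [leRHS]absE lecR.
Qed.

Lemma ultra_not_cvg0 (f : T -> CC R) : ~ (f t @[t --> U] --> (0 : CC R)) ->
  exists2 e : R[i], 0 < e & \forall t \near U, e <= `|f t|.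
Proof.
move=> /cvgr0Pnorm_lt/existsNP[e /not_implyP[e0 nlt]]; exists e => //.
have [//|] := in_ultra_setVsetC [set t | `|f t| < e] UU.
apply: filterS => t /= /negP.
by rewrite real_ltNge ?negbK // gtr0_real.
Qed.

(** Compare every character with one of maximal modulus along the
    ultrafilter. Either all the quotients tend to 0, or one of them stays
    between two positive constants; by taking a root, so does the character of
    a primitive vector [u], which then converges by compactness. *)
Lemma torus_degeneration (e1 e2 : lattice) r v1 :
  chi e1 @ U --> (0 : CC R) -> chi e2 @ U --> (0 : CC R) ->
  uniq r -> v1 \in r ->
  (exists2 v0, v0 \in r & forall c,
     (\forall t \near U, \sum_(v <- r) c v * chi v t = 0) -> c v0 = 0) \/
  (exists (u : lattice) (b1 b2 : CC R), [/\ 0 < det2 u e1, 0 < det2 u e2,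
     b1 != 0, b2 != 0 & forall d c, (forall v, v \in r -> d <= det2 u v) ->
       (\forall t \near U, \sum_(v <- r) c v * chi v t = 0) ->
       \sum_(v <- r | det2 u v == d) c v * torus_char b1 b2 v = 0]).
Proof.
move=> e10 e20 ur v1r; have [v0 v0r v0max] := dominant_exponent v1r.
have [dom|] := pselect (forall v, v \in r -> v != v0 ->
    chi (v - v0) @ U --> (0 : CC R)).
  left; exists v0 => // c; exact: (dominant_coef_eq0 x10 x20 v0r ur dom).
move=> /existsNP[w /not_implyP[wr /not_implyP[wv0 /ultra_not_cvg0[e e0 we]]]].
right; have [u [m [n [um n0 wE]]]] : exists u m n,
  [/\ det2 u m = 1, (0 < n)%N & w - v0 = u *+ n].
  by apply: primitive_direction; rewrite subr_eq0.
have bnd : \forall t \near U, e <= `|chi u t| <= 1.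
  apply: filterS (filterI we v0max) => t /= [et /(_ w wr)].
  by move: et; rewrite wE torus_charMn //; exact: norm_root_bounds.
have [b ub] : exists b : CC R, chi u t @[t --> U] --> b.
  by apply: ultra_complex_cvg; apply: filterS bnd => t /andP[].
have b0 : b != 0.
  apply/eqP => b0; move: ub; rewrite b0 => /cvgr0Pnorm_lt/(_ e e0) lte.
  have [t [/= /andP[et _] te]] := filter_ex (filterI bnd lte).
  by have := le_lt_trans et te; rewrite ltxx.
(* The weight of e1 is not 0, and changing the signs of u and m reverses it. *)
wlog ue1 : u m b um ub b0 {bnd wE} / 0 < det2 u e1 => [wl|].
  have ue0 : det2 u e1 != 0.
    exact: (chi_transverse_neq0 x10 x20 um b0 ub e10).
  have [ue1|ue1] := ltP 0 (det2 u e1); first exact: (wl u m b).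
  have umN : det2 (- u) (- m) = 1 by rewrite det2NN.
  have bV0 : b^-1 != 0 by rewrite invr_eq0.
  have ubN : chi (- u) t @[t --> U] --> b^-1.
    by under eq_fun do rewrite torus_charN; apply: cvgV; [exact: b0|exact: ub].
  apply: (wl (- u) (- m) b^-1 umN ubN bV0).
  by rewrite det2N oppr_gt0 lt_neqAle ue0.
exists u, (b ^ m.2), (b ^ (- m.1)); split; rewrite ?expfz_neq0 //.
  exact: (chi_transverse_gt0 x10 x20 um b0 ub ue1 e10 e20).
move=> d c dmin eq0.
exact: (initial_sum_eq0 x10 x20 um b0 ub ue1 e10 dmin eq0).
Qed.

End Degeneration.

(** * Nondegeneracy and isolated critical points *)

Section FacePart.
Variables (R : realType) (p q : nat).
Implicit Types (g : laurent R) (F : set (R * R)).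

Lemma mcoeff_face_part g F v :
  mcoeff v (face_part g F) = if `[< F (emb R v) >] then mcoeff v g else 0.
Proof.
rewrite /face_part raddf_sum /=.
transitivity (\sum_(w <- msupp g | w == v)
    if `[< F (emb R v) >] then mcoeff w g else 0); last first.
  by case: ifP => _; [rewrite mcoeff_sum_eq|rewrite big1].
rewrite big_mkcond [RHS]big_mkcond; apply: eq_bigr => w _.
rewrite mcoeffZ mcoeffU; have [->|_] := eqVneq w v; first by rewrite mulr1.
by rewrite mulr0 if_same.
Qed.

(** The function [phi] is arbitrary so as to cover the value of the face
    polynomial and both of its Euler derivatives. *)
Lemma face_part_sum g F (phi : lattice -> CC R) :
  \sum_(v <- msupp (face_part g F)) (mcoeff v (face_part g F) : CC R) * phi v =
  \sum_(v <- msupp g | `[< F (emb R v) >]) (mcoeff v g : CC R) * phi v.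
Proof.
have sub : (msupp (face_part g F) `<=` msupp g)%fset.
  apply/fsubsetP => v; rewrite -!mcoeff_neq0 mcoeff_face_part.
  by case: ifP; rewrite ?eqxx.
rewrite (big_fset_incl _ sub) => [|v _ vF]; last first.
  by rewrite mcoeff_outdom ?mul0r.
rewrite [RHS]big_mkcond; apply: eq_bigr => v _; rewrite mcoeff_face_part.
by case: ifP; rewrite ?mul0r.
Qed.

(** On the exponents of least weight [d], Euler's relation expresses [d] times
    the value of the face polynomial by its two derivatives; and [d] is not 0
    because the origin is not an exponent of [g]. *)
Lemma nondegenerate_no_singular g (u : lattice) (b1 b2 : CC R) v1 :
  (0 < p)%N -> poly_fun p q g -> newton_nondegenerate p q g ->
  mcoeff 0 g = 0 -> v1 \in msupp g ->
  0 < det2 u (1, 0) -> 0 < det2 u (q%:Z, p%:Z) -> b1 != 0 -> b2 != 0 ->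
  (forall (d : int) (e : lattice -> int), e = fst \/ e = snd ->
     (forall v, v \in msupp g -> d <= det2 u v) ->
     \sum_(v <- msupp g | det2 u v == d)
       (mcoeff v g : CC R) * ((e v)%:~R * torus_char b1 b2 v) = 0) ->
  False.
Proof.
move=> p0 hg hnd g0 v1g u1 un b10 b20 sum0.
have [v0 v0g vmin] := seq_argmin (det2 u) v1g.
have d0 : det2 u v0 != 0.
  apply/eqP => uv0.
  have [_ /(_ _)] := sigma_dual_weight u1 un p0 (hg _ v0g).
  rewrite dot_emb uv0 => /(_ erefl)/eqP.
  rewrite -pair_eqE /pair_eq /= !intr_eq0 => v00.
  have v0E : v0 = 0 by apply/eqP; rewrite -pair_eqE.
  by move: v0g; rewrite -mcoeff_neq0 v0E g0 eqxx.
have [F [faceF compactF FE]] := newton_face u1 un p0 vmin v0g erefl.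
have [smooth _] := hnd F faceF compactF.
have faceE (phi : lattice -> CC R) :
    \sum_(v <- msupp (face_part g F)) (mcoeff v (face_part g F) : CC R) * phi v =
    \sum_(v <- msupp g | det2 u v == det2 u v0) (mcoeff v g : CC R) * phi v.
  rewrite face_part_sum big_seq_cond [RHS]big_seq_cond; apply: eq_bigl => v.
  have [vg|//] := boolP (v \in msupp g); rewrite /=.
  by apply/asboolP/eqP => /(FE _ vg).
have theta0 e : e = fst \/ e = snd -> laurent_theta (face_part g F) e b1 b2 = 0.
  by move=> eE; rewrite /laurent_theta faceE; exact: sum0.
apply: (smooth b1 b2 b10 b20).
  (* Multiply the value by the weight, to apply Euler's relation. *)
  apply/eqP; rewrite -(mulrI_eq0 _ (@mulfI _ (det2 u v0)%:~R _)); last first.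
    by rewrite intr_eq0.
  apply/eqP; rewrite /laurent_eval faceE mulr_sumr.
  transitivity ((u.1)%:~R * laurent_theta (face_part g F) snd b1 b2 -
                (u.2)%:~R * laurent_theta (face_part g F) fst b1 b2); last first.
    by rewrite !theta0 ?mulr0 ?subr0; [|left|right].
  rewrite /laurent_theta !faceE !mulr_sumr -sumrB; apply: eq_bigr => v /eqP <-.
  rewrite /det2 rmorphB !rmorphM /= /torus_char; ring.
split.
  apply: (etrans (derive1_val (is_derive_laurent1 (face_part g F) b2 b10))).
  by rewrite theta0 ?mulr0 //; left.
apply: (etrans (derive1_val (is_derive_laurent2 (face_part g F) b1 b20))).
by rewrite theta0 ?mulr0 //; right.
Qed.

End FacePart.

Section Isolation.
Variables (R : realType) (s : seq nat).
Notation Cn := ('rV[CC R]_(size s).+2).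
Implicit Types (g : laurent R) (T : set Cn).

(** The restriction of [g] to the axis is a nonconstant polynomial, and its
    derivative has finitely many zeros. *)
Lemma axis_noncritical (j : 'I_(size s).+2) g T k :
  extreme_ray j -> (0 < k)%N -> mcoeff (hj_gen s j *+ k) g != 0 ->
  (forall t, t != 0 -> T (axis_point j t)) ->
  (forall z, T z -> exists2 t, t != 0 & z = axis_point j t) ->
  \forall z \near (0 : Cn), ~ crit_locus (eval_at g) T z.
Proof.
move=> ej k0 gk jT Tj; have [P [PE gP]] := eval_at_axis g ej.
have P'0 : P^`() != 0.
  apply/eqP => /polyP/(_ k.-1); rewrite coef_deriv coef0 prednK // PE.
  by apply/eqP; rewrite mulrn_eq0 negb_or -lt0n k0.
apply: filterS (near0_coord_horner j P'0) => z zP crit.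
have [Tz _] := crit; have [t t0 zE] := Tj _ Tz.
move: zP crit; rewrite zE mxE eqxx => /(_ t0)/eqP P't crit.
exact: P't (crit_axis gP jT t0 crit).
Qed.

(** The restriction of [g] to the axis is the zero polynomial. *)
Lemma axis_critical (j : 'I_(size s).+2) g T :
  extreme_ray j -> (forall k, mcoeff (hj_gen s j *+ k) g = 0) ->
  (forall t, t != 0 -> T (axis_point j t)) ->
  (forall z, T z -> exists2 t, t != 0 & z = axis_point j t) ->
  forall V, nbhs (0 : Cn) V ->
    exists z, [/\ V z, z != 0 & crit_locus (eval_at g) T z].
Proof.
move=> ej gj jT Tj V V0; have [P [PE gP]] := eval_at_axis g ej.
have P0 : P = 0 by apply/polyP => k; rewrite coef0 PE.
have [t t0 Vt] := ray_meets_nbhs (delta_mx 0 j) V0.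
rewrite -axis_pointE in Vt.
exists (axis_point j t); split; [exact: Vt|exact: axis_point_neq0|].
apply: (crit_locus_cst (a := 0)) (jT _ t0) => z /Tj[r _ ->].
by rewrite gP P0 horner0.
Qed.

(** An ultrafilter of critical points converging to the origin would
    degenerate, by [torus_degeneration], either to an exponent of [g] that is
    zero or to a singular point of a face polynomial. *)
Lemma torus_noncritical (p q : nat) g T v1 :
  (0 < p)%N -> hj_gen s (size s).+1 = (q%:Z, p%:Z) ->
  poly_fun p q g -> newton_nondegenerate p q g ->
  mcoeff 0 g = 0 -> v1 \in msupp g ->
  (forall x1 x2 : CC R, x1 != 0 -> x2 != 0 -> T (torus_point s x1 x2)) ->
  (forall z, T z -> exists x1 x2 : CC R,
     [/\ x1 != 0, x2 != 0 & z = torus_point s x1 x2]) ->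
  \forall z \near (0 : Cn), ~ crit_locus (eval_at g) T z.
Proof.
move=> p0 hl hg hnd g0 v1g hT Tt; set Z := crit_locus _ _.
apply: contrapT => Zacc.
(* Critical points accumulating at 0 form a proper filter. *)
have FZ : ProperFilter (within Z (nbhs (0 : Cn))).
  by apply: Build_ProperFilter => ZF; apply: Zacc.
have [U [UU ZU]] := ultraFilterLemma FZ.
have UZ : U Z by apply: ZU; exact: withinT.
have U0 : nbhs (0 : Cn) `<=` U by move=> V V0; apply: ZU; apply: filterS V0 => z.
have /choice[x xP] (z : Cn) : exists y : CC R * CC R,
    [/\ y.1 != 0, y.2 != 0 & Z z -> z = torus_point s y.1 y.2].
  have [[Tz _]|nZ] := pselect (Z z); last first.
    by exists (1, 1); split; [exact: oner_neq0|exact: oner_neq0|].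
  have [x1 [x2 [x10 x20 zE]]] := Tt _ Tz.
  by exists (x1, x2); split; [exact: x10|exact: x20|move=> _; exact: zE].
have x10 z : (x z).1 != 0 by have [] := xP z.
have x20 z : (x z).2 != 0 by have [] := xP z.
have xE z : Z z -> z = torus_point s (x z).1 (x z).2 by have [] := xP z.
have chi0 (i : 'I_(size s).+2) :
    torus_char (x z).1 (x z).2 (hj_gen s i) @[z --> U] --> (0 : CC R).
  have zi : z 0 i @[z --> U] --> (0 : CC R).
    have := @coord_continuous _ 1 (size s).+2 0 i (0 : Cn).
    rewrite /continuous_at mxE; apply: cvg_trans; exact: cvg_app U0.
  apply: cvg_trans zi; apply: near_eq_cvg; apply: filterS UZ => z /xE.
  by move=> {1}->; rewrite mxE.
have theta0 (e : lattice -> int) : e = fst \/ e = snd -> \forall z \near U,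
    \sum_(v <- msupp g) ((mcoeff v g : CC R) * (e v)%:~R) *
      torus_char (x z).1 (x z).2 v = 0.
  move=> eE; apply: filterS UZ => z Zz.
  have gE (y1 y2 : CC R) : y1 != 0 -> y2 != 0 ->
    eval_at g (torus_point s y1 y2) = laurent_eval g y1 y2.
    by move=> y10 y20; exact: eval_at_torus hl hg y10 y20.
  have := Zz; rewrite {1}(xE _ Zz) => /(crit_torus gE hT (x10 z) (x20 z))[t1 t2].
  transitivity (laurent_theta g e (x z).1 (x z).2).
    by apply: eq_bigr => v _; rewrite -mulrA.
  by case: eE => ->.
have [[v0 v0g dom]|[u [b1 [b2 [u1 un b10 b20 sum0]]]]] :=
  torus_degeneration x10 x20 (chi0 ord0) (chi0 ord_max) (fset_uniq (msupp g)) v1g.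
  have v0E (e : lattice -> int) : e = fst \/ e = snd -> e v0 = 0.
    move=> /theta0/(dom (fun v => (mcoeff v g : CC R) * (e v)%:~R))/eqP.
    rewrite mulf_eq0 intr_eq0 => /orP[|/eqP //].
    by rewrite mcoeff_eq0 v0g.
  have v00 : v0 = 0.
    by rewrite (surjective_pairing v0) (v0E fst) ?(v0E snd) //; [right|left].
  by move: v0g; rewrite v00 -mcoeff_neq0 g0 eqxx.
move: un; rewrite [hj_gen s ord_max]hl => un.
apply: (nondegenerate_no_singular p0 hg hnd g0 v1g u1 un b10 b20) => d e eE dmin.
have := sum0 d _ dmin (theta0 e eE).
by move=> {2}<-; apply: eq_bigr => v _; rewrite mulrA.
Qed.

End Isolation.

Section Orbits.
Variables (R : realType) (p q : nat) (s : seq nat).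
Notation Cn := ('rV[CC R]_(size s).+2).

(** Choose a [q]-th root of [t] for the first coordinate of the torus. *)
Lemma orbit2_axis (t : CC R) : (0 < q)%N -> t != 0 ->
  orbit2 p q (axis_point ord_max t : Cn).
Proof.
move=> q0 t0; exists (q.-root (t : R[i])), 1; split; last first.
- by apply/rowP => i; rewrite !mxE expr1n mulr1 rootCK.
- exact: oner_neq0.
- by rewrite rootC_eq0.
Qed.

Lemma axis_orbit2 (z : Cn) : orbit2 p q z ->
  exists2 t, t != 0 & z = axis_point ord_max t.
Proof.
move=> [t1 [t2 [t10 t20 ->]]]; exists (t1 ^+ q * t2 ^+ p) => //.
by rewrite mulf_neq0 // expf_neq0.
Qed.

Lemma mcoeff0_eval_at0 (g : laurent R) : @extreme_ray s ord0 ->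
  eval_at g (0 : Cn) = 0 -> mcoeff 0 g = 0.
Proof.
move=> e0; have [P [PE gP]] := eval_at_axis g e0.
have -> : (0 : Cn) = axis_point ord0 0.
  by apply/rowP => i; rewrite !mxE if_same.
by rewrite gP horner_coef0 PE mulr0n.
Qed.

Lemma mcoeff_comb (f A B : laurent R) (a b : R[i]) v :
  mcoeff v (a *: A + f + b *: B) =
    a * mcoeff v A + mcoeff v f + b * mcoeff v B.
Proof. by rewrite raddfD raddfD /=; congr (_ + _ + _); exact: mcoeffZ. Qed.

(** Take for [h] the difference of [g] and two of its terms. The two exponents
    differ because only multiples of the first generator have second
    coordinate 0. *)
Lemma normal_formP (g : laurent R) : poly_fun p q g -> (0 < p)%N ->
  hj_gen s (size s).+1 = (q%:Z, p%:Z) ->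
  (exists2 k, (0 < k)%N & mcoeff (hj_gen s 0 *+ k) g != 0) /\
  (exists2 k, (0 < k)%N & mcoeff (hj_gen s (size s).+1 *+ k) g != 0) <->
  exists (c1 cn : R[i]) (p1 pn : nat) (h : laurent R),
    [/\ c1 != 0 /\ cn != 0,
        (0 < p1)%N /\ (0 < pn)%N,
        poly_fun p q h,
        mcoeff (hj_gen s 0 *+ p1) h = 0 /\
        mcoeff (hj_gen s (size s).+1 *+ pn) h = 0 &
        g = c1 *: @coord_pow R s ord0 p1 + h + cn *: @coord_pow R s ord_max pn].
Proof.
move=> hg p0 hl.
have neq k l : (0 < l)%N ->
    (hj_gen s 0 *+ k == hj_gen s (size s).+1 *+ l) = false.
  move=> l0; apply/eqP => /(congr1 snd); rewrite hl !snd_mulrn /=; nia.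
have mono1 k v : mcoeff v (@coord_pow R s ord0 k) = (hj_gen s 0 *+ k == v)%:R.
  exact: mcoeffU.
have monon k v : mcoeff v (@coord_pow R s ord_max k) =
    (hj_gen s (size s).+1 *+ k == v)%:R by exact: mcoeffU.
split=> [[[k k0 gk] [l l0 gl]]|[c1 [cn [k [l [h]]]]]]; last first.
  move=> [[c10 cn0] [k0 l0] hh [hk hl'] gE]; split.
    exists k => //; rewrite gE mcoeff_comb mono1 monon eqxx hk.
    by rewrite [_ *+ l == _]eq_sym neq // mulr1 mulr0 !addr0.
  exists l => //; rewrite gE mcoeff_comb mono1 monon eqxx hl' neq //.
  by rewrite mulr0 mulr1 !add0r.
have [c1 c1E] : exists c1, c1 = mcoeff (hj_gen s 0 *+ k) g by eexists.
have [cn cnE] : exists cn, cn = mcoeff (hj_gen s (size s).+1 *+ l) g.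
  by eexists.
rewrite -c1E in gk; rewrite -cnE in gl.
have [h gE] : exists h,
    g = c1 *: @coord_pow R s ord0 k + h + cn *: @coord_pow R s ord_max l.
  exists (g - cn *: @coord_pow R s ord_max l - c1 *: @coord_pow R s ord0 k).
  by rewrite [c1 *: _ + _]addrC !subrK.
have hE v : mcoeff v h = mcoeff v g - c1 * (hj_gen s 0 *+ k == v)%:R -
    cn * (hj_gen s (size s).+1 *+ l == v)%:R.
  by rewrite gE mcoeff_comb mono1 monon; ring.
exists c1, cn, k, l, h; split=> //.
  move=> v vh; apply: hg; apply: contraTT vh; rewrite -!mcoeff_eq0 => /eqP v0.
  rewrite hE v0 sub0r; have [vE|_] := eqVneq (hj_gen s 0 *+ k) v.
    by move: gk; rewrite c1E vE v0 eqxx.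
  have [vE|_] := eqVneq (hj_gen s (size s).+1 *+ l) v.
    by move: gl; rewrite cnE vE v0 eqxx.
  by rewrite !mulr0 !oppr0 addr0.
split; rewrite hE eqxx.
  by rewrite eq_sym neq // mulr1 mulr0 subr0 c1E subrr.
by rewrite neq // mulr1 mulr0 subr0 cnE subrr.
Qed.

End Orbits.

Unset Implicit Arguments.

Theorem lemma5p4 (R : realType) (p q : nat) (s : seq nat)
    (hq : (0 < q)%N) (hqp : (q < p)%N) (hpq : coprime p q)
    (hs : all (fun a => (2 <= a)%N) s)
    (hhj : p%:R / (p%:R - q%:R) = hj_frac s)
    (g : laurent R) (hg : poly_fun p q g) (hg0 : eval_at g (0 : 'rV[CC R]_(size s).+2) = 0)
    (hnd : newton_nondegenerate p q g) :
  isolated_singularity p q s g <->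
  exists (c1 cn : R[i]) (p1 pn : nat) (h : laurent R),
    [/\ c1 != 0 /\ cn != 0,
        (0 < p1)%N /\ (0 < pn)%N,
        poly_fun p q h,
        mcoeff (hj_gen s 0 *+ p1) h = 0 /\
        mcoeff (hj_gen s (size s).+1 *+ pn) h = 0 &
        g = c1 *: @coord_pow R s ord0 p1 + h + cn *: @coord_pow R s ord_max pn].
Proof.
have p0 : (0 < p)%N by exact: leq_ltn_trans hqp.
have hl : hj_gen s (size s).+1 = (q%:Z, p%:Z).
  by rewrite hj_gen_last (hj_numden_frac hq hqp hpq hs hhj) /= subKr.
have e1 := extreme_ray_first hs; have en := extreme_ray_last hs.
have g0 := mcoeff0_eval_at0 e1 hg0.
apply: iff_trans (normal_formP hg p0 hl).
have o1 (t : CC R) : t != 0 -> orbit1 (axis_point (s := s) ord0 t).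
  by move=> t0; exists t.
have a1 z : @orbit1 R s z -> exists2 t, t != 0 & z = axis_point ord0 t.
  by move=> [t t0 ->]; exists t.
have o2 (t : CC R) : t != 0 -> orbit2 p q (axis_point (s := s) ord_max t).
  exact: orbit2_axis.
have a2 z := @axis_orbit2 R p q s z.
have o3 (x1 x2 : CC R) : x1 != 0 -> x2 != 0 -> orbit3 (torus_point s x1 x2).
  by move=> x10 x20; exists x1, x2.
have a3 z : @orbit3 R s z -> exists x1 x2 : CC R,
    [/\ x1 != 0, x2 != 0 & z = torus_point s x1 x2].
  by move=> [x1 [x2 [x10 x20 ->]]]; exists x1, x2.
pose A := \bigcup_(T in @strata R p q s) crit_locus (eval_at g) T.
have A0 : A 0.
  exists (@orbit0 R s); first by do 3 left.
  by apply: (crit_locus_cst (a := 0)) => // z ->.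
split=> [[_ [V V0 VA]]|[[k k0 gk] [l l0 gl]]].
  have ray (j : 'I_(size s).+2) T : @strata R p q s T -> extreme_ray j ->
      (forall t, t != 0 -> T (axis_point j t)) ->
      (forall z, T z -> exists2 t, t != 0 & z = axis_point j t) ->
      exists2 k, (0 < k)%N & mcoeff (hj_gen s j *+ k) g != 0.
    move=> sT ej jT Tj; apply: contrapT => nk.
    have gj k : mcoeff (hj_gen s j *+ k) g = 0.
      case: k => [|k]; first by rewrite mulr0n.
      by apply: contrapT => /eqP gk; apply: nk; exists k.+1.
    have [z [Vz z0 cz]] := axis_critical ej gj jT Tj V0.
    have : (V `&` A) z by split; [exact: Vz|exists T].
    by rewrite VA => z0'; rewrite z0' eqxx in z0.
  split.
    by apply: (ray ord0 (@orbit1 R s)) => //; left; left; right.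
  by apply: (ray ord_max (@orbit2 R p q s)) => //; left; right.
split; first exact/mem_set.
have n1 := axis_noncritical (g := g) e1 k0 gk o1 a1.
have n2 := axis_noncritical (g := g) en l0 gl o2 a2.
have v1g : hj_gen s 0 *+ k \in msupp g by rewrite -mcoeff_neq0.
have n3 := torus_noncritical p0 hl hg hnd g0 v1g o3 a3.
pose V : set 'rV[CC R]_(size s).+2 := [set z |
  [/\ ~ crit_locus (eval_at g) (@orbit1 R s) z,
      ~ crit_locus (eval_at g) (@orbit2 R p q s) z &
      ~ crit_locus (eval_at g) (@orbit3 R s) z]].
have V0 : nbhs (0 : 'rV[CC R]_(size s).+2) V.
  by apply: filterS (filterI n1 (filterI n2 n3)) => z [? [? ?]]; split.
exists V => //; apply/seteqP.
split=> [z [[c1 c2 c3] [T sT cT]]|_ ->]; last first.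
  by split; [exact: nbhs_singleton V0|exact: A0].
by case: sT cT => [[[->|->]|->]|->] // [].
Qed.
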